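(* Let $a_1,\dots,a_s$ be positive integers with $\max\{a_1,\dots,a_s\}=7$ and $m=\sum_{i=1}^s(a_i-1)+1\ge 13$. Then $F_v(a_1,\dots,a_s;8)\ge 3m-10$. In particular, $F_v(7,7;8)\ge 29$.
   Context: All graphs are finite, simple and undirected; $\omega(G)$ denotes the clique number. Write $G \overset{v}{\rightarrow} (a_1,\dots,a_s)$ if for every coloring of the vertices of $G$ with $s$ colors there exists $i$ such that $G$ contains a clique on $a_i$ vertices all of whose vertices have color $i$. $F_v(a_1,\dots,a_s;q)$ is the minimum number of vertices of a graph $G$ with $G \overset{v}{\rightarrow} (a_1,\dots,a_s)$ and $\omega(G)<q$. *)

(* Defs.v *)
From mathcomp Require Import all_boot.
Set Implicit Arguments. Unset Strict Implicit. Unset Printing Implicit Defensive.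

Definition simple_graph (T : finType) (e : rel T) : Prop :=
  symmetric e /\ irreflexive e.

Definition is_clique (T : finType) (e : rel T) (K : {set T}) : Prop :=
  forall x y, x \in K -> y \in K -> x != y -> e x y.

Definition clique_num_lt (T : finType) (e : rel T) (q : nat) : Prop :=
  forall K : {set T}, is_clique e K -> #|K| < q.

Definition vertex_arrows (T : finType) (e : rel T) (a : seq nat) : Prop :=
  forall c : T -> 'I_(size a),
    exists i : 'I_(size a), exists K : {set T},
      [/\ #|K| = nth 0 a i, is_clique e K & forall x, x \in K -> c x = i].

Definition Fv_ge (a : seq nat) (q k : nat) : Prop :=
  forall (T : finType) (e : rel T),
    simple_graph e -> vertex_arrows e a -> clique_num_lt e q -> k <= #|T|.

Definition mFolk (a : seq nat) : nat := sumn [seq x.-1 | x <- a] + 1.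

(* Main.v *)
Require Import Defs.
From mathcomp Require Import all_boot.
From mathcomp Require Import zify.
Set Implicit Arguments. Unset Strict Implicit. Unset Printing Implicit Defensive.

(* Let H be the complement of G, so that cliques of G are independent sets of H
   and H has no independent 8-set. Grouping t = m - 7 independent colour classes
   of G into blocks of sizes a_i - 1 shows that any t disjoint cliques of H miss
   some independent 7-set. Let f(t) be the least order of such a graph; we need
   f(t) >= 3t + 11 for t >= 6. Deleting an edge of H gives f(t+1) >= f(t) + 2,
   and if H has a triangle, deleting it gives f(t+1) >= f(t) + 3. By Hall's
   theorem every nonempty independent set O of H has at least |O| + t
   neighbours; so f(1) >= 15, all degrees exceed t, and as a vertex off all
   triangles has degree at most 7, H has triangles for t >= 7.

   The bounds f(3) >= 20 and f(4) >= 23 need that no triangle-free H has order 19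
   (t = 3) or 22 (t = 4). Such an H has a near-perfect matching. Putting a vertex
   y into an independent set that meets every matching edge forces other vertices
   in, and this propagation reaches a contradiction within few matching edges;
   hence few matching edges already admit no independent transversal, and t of
   the remaining ones can be deleted.

   For t = 6 and order 28, two disjoint triangles reduce to f(4). Otherwise
   König's theorem shows that two vertices off all triangles have at most one
   common neighbour, so by double counting at most 8 vertices are off all
   triangles; pairwise intersecting triangles cannot cover the other 20. *)

(** * Hall's marriage theorem *)

Section Hall.
Context {T : finType}.
Implicit Types (r : rel T) (A O : {set T}).

Definition nbhd r O : {set T} := [set y | [exists x in O, r x y]].

Lemma nbhdP r O y : reflect (exists2 x, x \in O & r x y) (y \in nbhd r O).
Proof. by rewrite inE; apply: exists_inP. Qed.

Lemma nbhdU r A O : nbhd r (A :|: O) = nbhd r A :|: nbhd r O.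
Proof.
apply/setP => y; rewrite in_setU; apply/nbhdP/orP.
  by case=> x /setUP[] xA rxy; [left|right]; apply/nbhdP; exists x.
by case=> /nbhdP[x xA rxy]; exists x; rewrite // in_setU xA ?orbT.
Qed.

(** Induction on [#|A|]. If a nonempty proper subset [O] has at most [#|O|] neighbours, match [O]
    into them and [A :\: O] outside them. Otherwise each such subset has a neighbour to spare, so
    one vertex is matched arbitrarily and its partner discarded. *)
Lemma hall_matching r A :
    (forall O, O \subset A -> #|O| <= #|nbhd r O|) ->
  exists f : T -> T, {in A, forall x, r x (f x)} /\ {in A &, injective f}.
Proof.
move: {2}#|A| (leqnn #|A|) => n; elim: n A r => [|n IHn] A r.
  rewrite leqn0 cards_eq0 => /eqP-> _; exists id.
  by split=> [x|x y]; rewrite inE.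
move=> leAn hallA; have [->|[a aA]] := set_0Vmem A.
  by exists id; split=> [x|x y]; rewrite inE.
have [/exists_inP[O]|] := boolP [exists O in powerset A,
    [&& O != set0, O != A & #|nbhd r O| <= #|O|]].
  rewrite powersetE => OA /and3P[O0 OneA tightO].
  have ltOA : O \proper A by rewrite properEneq OneA.
  have [|O' sO'O|f1 [f1r f1inj]] := IHn O r.
  - by rewrite -ltnS; apply: leq_trans leAn; apply: proper_card.
  - by apply: hallA; apply: subset_trans OA.
  (* As [O] is tight, Hall's condition for [r'] on [O'] follows from that for [r] on [O :|: O']. *)
  pose r' x y := r x y && (y \notin nbhd r O).
  have nb' O' : nbhd r' O' = nbhd r (O :|: O') :\: nbhd r O.
    apply/setP=> y; rewrite nbhdU !inE; apply/idP/idP.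
      case/exists_inP=> x xO' /andP[rxy]; rewrite inE => ->; rewrite orbC /=.
      by apply/orP; left; apply/exists_inP; exists x.
    case/andP=> nyO /orP[yO|/exists_inP[x xO' rxy]]; first by rewrite yO in nyO.
    by apply/exists_inP; exists x; rewrite // /r' rxy inE.
  have [||f2 [f2r f2inj]] := IHn (A :\: O) r'.
  - rewrite -ltnS; apply: leq_trans leAn; apply: proper_card.
    rewrite properEneq subsetDl andbT; apply: contraNneq O0 => AO.
    by rewrite -subset0; apply/subsetP=> x xO; move: (subsetP OA _ xO);
       rewrite -AO inE xO.
  - move=> O'; rewrite subsetD => /andP[O'A dO'].
    rewrite nb' cardsD (setIidPr _); last by rewrite nbhdU subsetUl.
    have := hallA (O :|: O'); rewrite subUset OA O'A => /(_ isT).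
    rewrite cardsU (_ : O :&: O' = set0) ?cards0; first lia.
    by apply/eqP; rewrite setI_eq0 disjoint_sym.
  exists (fun x => if x \in O then f1 x else f2 x); split=> [x xA|x y xA yA].
    case: ifP => xO; first exact: f1r.
    by have /andP[]: r' x (f2 x) by apply: f2r; rewrite inE xO xA.
  case: ifP => xO; case: ifP => yO.
  - exact: f1inj.
  - move=> f12; have /andP[_ /nbhdP[]]: r' y (f2 y) by apply: f2r; rewrite inE yO.
    by exists x; rewrite // -f12; apply: f1r.
  - move=> f12; have /andP[_ /nbhdP[]]: r' x (f2 x) by apply: f2r; rewrite inE xO.
    by exists y; rewrite // f12; apply: f1r.
  - by apply: f2inj; rewrite inE ?xO ?yO.
rewrite negb_exists_in => /forall_inP surplus.
have [y ray] : exists y, r a y.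
  have := hallA [set a]; rewrite sub1set cards1 => /(_ aA).
  by case/card_gt0P=> y /nbhdP[x /set1P-> ray]; exists y.
pose r' x z := r x z && (z != y).
have [||f [fr finj]] := IHn (A :\ a) r'.
- by rewrite (cardsD1 a) aA in leAn; rewrite -ltnS.
- move=> O sO; have [->|O0] := eqVneq O set0; first by rewrite cards0.
  have sOA : O \subset A by apply: subset_trans sO (subsetDl _ _).
  have := surplus O; rewrite powersetE O0 sOA => /(_ isT) /=.
  have -> /= : O != A.
    by apply: contraTneq sO => ->; apply/subsetPn; exists a; rewrite // !inE eqxx.
  rewrite -ltnNge => lt; rewrite -ltnS; apply: leq_trans lt _.
  have -> : nbhd r' O = nbhd r O :\ y.
    apply/setP=> z; rewrite !inE; apply/exists_inP/andP.
      by case=> x xO /andP[rxz ->]; split=> //; apply/exists_inP; exists x.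
    by case=> zy /exists_inP[x xO rxz]; exists x; rewrite // /r' rxz.
  by rewrite (cardsD1 y (nbhd r O)); case: (_ \in _); lia.
exists (fun x => if x == a then y else f x); split=> [x xA|x z xA zA].
  case: eqVneq => [->//|xa].
  by have /andP[]: r' x (f x) by apply: fr; rewrite !inE xa.
case: eqVneq => [->|xa]; case: eqVneq => [->//|za].
- move=> yf; have /andP[_]: r' z (f z) by apply: fr; rewrite !inE za.
  by rewrite -yf eqxx.
- move=> yf; have /andP[_]: r' x (f x) by apply: fr; rewrite !inE xa.
  by rewrite yf eqxx.
- by apply: finj; rewrite !inE ?xa ?za.
Qed.

End Hall.

(** * Arrowing in the complement *)

Section Arrow.
Context {T : finType} (h : rel T).
Hypotheses (hsym : symmetric h) (hirr : irreflexive h).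
Implicit Types (V A B C I J K O : {set T}) (x y z : T) (t k : nat).

Definition indep I := [forall x in I, forall y in I, ~~ h x y].

Definition nb V x : {set T} := [set y in V | h x y].

Definition nbs V O : {set T} := nbhd (fun x y => h x y && (y \in V)) O.

Definition clique_cover (rT : Type) (f : T -> rT) (B : {set T}) :=
  {in B &, forall x y, f x = f y -> x != y -> h x y}.

(* For [h] the complement of [e], this is e[V] -> (2, ..., 2, 7) with t twos: the
   colours below [t] are those required to be free of edges of [e]. *)
Definition arr V t := forall f : T -> nat,
  {in V &, forall x y, f x = f y -> f x < t -> x != y -> h x y} ->
  exists K, [/\ K \subset V, indep K, #|K| = 7 & {in K, forall x, t <= f x}].

Lemma indepP I : reflect {in I &, forall x y, ~~ h x y} (indep I).
Proof.
apply: (iffP forall_inP) => [hI x y xI yI|hI x xI].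
  exact: (forall_inP (hI x xI)).
by apply/forall_inP => y yI; apply: hI.
Qed.

Lemma indepS A B : A \subset B -> indep B -> indep A.
Proof.
move=> /subsetP sAB /indepP iB; apply/indepP => x y /sAB xB /sAB yB.
exact: iB.
Qed.

Lemma indepU A B : indep A -> indep B -> {in A & B, forall x y, ~~ h x y} ->
  indep (A :|: B).
Proof.
move=> /indepP iA /indepP iB iAB; apply/indepP => x y.
rewrite !inE => /orP[] xA /orP[] yA; [exact: iA|exact: iAB| |exact: iB].
by rewrite hsym iAB.
Qed.

Lemma indep1 x : indep [set x].
Proof. by apply/indepP => y z /set1P-> /set1P->; rewrite hirr. Qed.

Lemma indepU1 x A : indep A -> {in A, forall y, ~~ h x y} -> indep (x |: A).
Proof.
by move=> iA xA; apply: indepU (indep1 x) iA _ => y z /set1P-> /xA.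
Qed.

Lemma in_nb V x y : (y \in nb V x) = (y \in V) && h x y.
Proof. by rewrite inE. Qed.

Lemma nb_sub V x : nb V x \subset V.
Proof. by apply/subsetP=> y; rewrite in_nb => /andP[]. Qed.

Lemma nbsP V O y :
  reflect (exists2 x, x \in O & h x y && (y \in V)) (y \in nbs V O).
Proof. exact: nbhdP. Qed.

Lemma nbs1 V x : nbs V [set x] = nb V x.
Proof.
apply/setP=> y; rewrite in_nb andbC; apply/nbsP/idP => [[z /set1P->]//|hxy].
by exists x; rewrite ?set11.
Qed.

Lemma arr_indep V t : arr V t -> exists K, [/\ K \subset V, indep K & #|K| = 7].
Proof. by move=> /(_ (fun=> t))[x y _ _ _|K []]; [rewrite ltnn|exists K]. Qed.

(** The clique [C] becomes the new colour class 0 and all other colours move up by one. *)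
Lemma arr_remove V C t : {in C &, forall x y, x != y -> h x y} ->
  arr V t.+1 -> arr (V :\: C) t.
Proof.
move=> clC arrV f clf; pose g x := if x \in C then 0 else (f x).+1.
have [x y xV yV|K [sKV iK cK gK]] := arrV g.
  rewrite /g; case: ifP => xC; case: ifP => yC //; first by move=> _ _; apply: clC.
  by case=> fxy lt; apply: clf; rewrite // inE ?xC ?yC.
exists K; split=> // [|x xK]; last by move: (gK x xK); rewrite /g; case: ifP.
apply/subsetP=> x xK; rewrite inE (subsetP sKV) // andbT.
by apply: contraTN (gK x xK) => xC; rewrite /g xC.
Qed.

(** A class consists of some [z] outside [A], or of the vertex matched to [z], or of both, which are
    then adjacent. *)
Lemma match_cover (A B : {set T}) (f : T -> T) :
  {in A, forall x, h x (f x)} -> {in A &, injective f} ->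
  clique_cover (fun x => if x \in A then f x else x) B.
Proof.
move=> hf finj x y _ _; case: ifP => xA; case: ifP => yA.
- by move/(finj x y xA yA)=> ->; rewrite eqxx.
- by move<-=> _; apply: hf.
- by move-> => _; rewrite hsym hf.
- by move->; rewrite eqxx.
Qed.

Lemma indep_inj (rT : finType) (f : T -> rT) I B : clique_cover f B ->
  I \subset B -> indep I -> #|I| = #|f @: I|.
Proof.
move=> covf sIB /indepP iI; rewrite card_in_imset // => x y xI yI fxy.
apply: contraTeq isT => xy; have := iI x y xI yI.
by rewrite (covf x y) ?(subsetP sIB).
Qed.

(* Give the first [t] cliques of the cover the first [t] colours and all other
   vertices the last colour: the independent 7-set that [arr] provides has at
   most one vertex in each of the other cliques. *)
Lemma cover_bound (rT : finType) (f : T -> rT) V B t a : arr V t ->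
    clique_cover f B ->
    (forall I, I \subset V :\: B -> indep I -> #|I| <= a) ->
  6 < (#|f @: B| - t) + a.
Proof.
move=> arrV covf bnd; rewrite ltnNge; apply/negP => le6.
pose s := enum (f @: B); pose g x := if x \in B then index (f x) s else t.
have insB x : x \in B -> f x \in s by move=> xB; rewrite mem_enum imset_f.
have [x y _ _|K [sKV iK cK gK]] := arrV g.
  rewrite /g; case: ifP => xB; last by rewrite ltnn.
  case: ifP => yB; last by move=> ->; rewrite ltnn.
  by move=> /(congr1 (nth (f x) s)) + _; rewrite !nth_index ?insB //; apply: covf.
have sIB : K :&: B \subset B by apply: subsetIr.
(* [K] avoids the colours below [t], so it meets only the classes listed in [drop t s]. *)
have le1 : #|K :&: B| <= #|f @: B| - t.
  rewrite (indep_inj covf sIB) ?(indepS (subsetIl _ _)) //.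
  rewrite [X in _ <= X - _]cardE -size_drop.
  apply: leq_trans (card_size _); apply: subset_leq_card.
  apply/subsetP=> _ /imsetP[x xKB ->].
  move: xKB; rewrite inE => /andP[xK xB]; have := gK x xK; rewrite /g xB => ti.
  rewrite -(nth_index (f x) (insB x xB)) -(subnKC ti) -nth_drop mem_nth //.
  by rewrite size_drop ltn_sub2r // ?(leq_ltn_trans ti) ?index_mem ?insB.
have le2 : #|K :\: B| <= a.
  by apply: bnd; rewrite ?setSD // (indepS (subsetDl _ _)).
have := cardsID B K; lia.
Qed.

(** * Expansion and König's theorem when independent sets have at most 7 vertices *)

Section Alpha.
Hypothesis alpha7 : forall I, indep I -> #|I| <= 7.

Lemma nbs_nonadj V O x y : x \in O -> y \in V -> y \notin nbs V O -> ~~ h x y.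
Proof.
by move=> xO yV; apply: contra => hxy; apply/nbsP; exists x; rewrite ?hxy.
Qed.

(** An independent set outside the closed neighbourhood stays independent when [O] is added, so it
    has at most [7 - #|O|] vertices; [cover_bound] then needs at least [#|O|] classes besides the
    first [t]. *)
Lemma closed_nbhd_cover V t O (rT : finType) (f : T -> rT) : 0 < t -> arr V t ->
    O != set0 -> indep O -> clique_cover f (O :|: nbs V O) ->
  #|O| + t <= #|f @: (O :|: nbs V O)|.
Proof.
move=> t0 arrV O0 iO covf.
have := @cover_bound _ f V _ t (7 - #|O|) arrV covf.
move: O0 (alpha7 iO); rewrite -card_gt0 => O0 O7.
suff bnd : forall I, I \subset V :\: (O :|: nbs V O) -> indep I ->
  #|I| <= 7 - #|O| by move/(_ bnd); lia.
move=> I sI iI; suff: #|I :|: O| <= 7.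
  rewrite cardsU (_ : I :&: O = set0) ?cards0; first lia.
  apply/eqP; rewrite setI_eq0; apply/pred0P=> x /=; apply/andP=> -[xI xO].
  by move: (subsetP sI _ xI); rewrite !inE xO.
apply: alpha7; rewrite setUC; apply: indepU => // x y xO /(subsetP sI).
rewrite in_setD in_setU negb_or => /andP[/andP[_ yN] yV].
exact: nbs_nonadj yN.
Qed.

(* If Hall's condition fails on [O], a minimal violating subset [O'] has its
   closed neighbourhood covered by [#|O'|] cliques; otherwise a matching of [O]
   into its neighbourhood covers the closed neighbourhood of [O]. *)
Lemma expansion V t O : 0 < t -> arr V t -> O \subset V -> O != set0 ->
  indep O -> #|O| + t <= #|nbs V O|.
Proof.
move=> t0 arrV sOV O0 iO.
have imS (A O' : {set T}) f : {in A, forall x, h x (f x) && (f x \in V)} ->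
    A \subset O' -> [set (if x \in A then f x else x) | x in O' :|: nbs V O']
      \subset (O' :\: A) :|: nbs V O'.
  move=> fA sAO'; apply/subsetP=> _ /imsetP[x + ->].
  case: ifP => xA; rewrite !in_setU in_setD ?xA // => _.
  by apply/orP; right; apply/nbsP; exists x; [apply: (subsetP sAO')|apply: fA].
case: (pickP [pred O' : {set T} | (O' \subset O) && (#|nbs V O'| < #|O'|)]).
  move=> O1 /= PO1.
  have [O' /minsetP[/andP[sO' lt] minO'] _] := minset_exists
    (P := fun O' : {set T} => (O' \subset O) && (#|nbs V O'| < #|O'|)) PO1.
  have O'0 : O' != set0 by rewrite -card_gt0; apply: leq_ltn_trans lt.
  have [a aO'] := set0Pn _ O'0.
  (* By minimality Hall's condition holds on [O'] without one vertex [a]; [a] costs one extra class,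
     paid for by [#|nbs V O'| < #|O'|]. *)
  have [O'' sO''|f [fr finj]] := @hall_matching _
    (fun x y => h x y && (y \in V)) (O' :\ a).
    rewrite leqNgt; apply/negP => lt''.
    have sO2 : O'' \subset O' := subset_trans sO'' (subsetDl _ _).
    have := minO' O''; rewrite lt'' (subset_trans sO2) // => /(_ isT sO2) E.
    by move: (subsetP sO'' a); rewrite E aO' !inE eqxx => /(_ isT).
  have iO' := indepS sO' iO.
  have /(closed_nbhd_cover t0 arrV O'0 iO') := @match_cover (O' :\ a)
    (O' :|: nbs V O') f (fun x xA => proj1 (andP (fr x xA))) finj.
  have /subset_leq_card := imS _ _ _ fr (subsetDl O' [set a]).
  have -> : O' :\: (O' :\ a) = [set a].
    by rewrite setDDr setDv set0U; apply/setIidPr; rewrite sub1set.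
  by rewrite cardsU cards1; lia.
move=> hallO; have [O' sO'|f [fr finj]] := @hall_matching _
    (fun x y => h x y && (y \in V)) O.
  by have := hallO O'; rewrite /= sO' /= ltnNge => /negbFE.
have /(closed_nbhd_cover t0 arrV O0 iO) := @match_cover O
    (O :|: nbs V O) f (fun x xA => proj1 (andP (fr x xA))) finj.
have /subset_leq_card := imS _ _ _ fr (subxx O).
by rewrite setDv set0U; lia.
Qed.

Lemma arr_min_degree V t x : 0 < t -> arr V t -> x \in V -> t < #|nb V x|.
Proof.
move=> t0 arrV xV; rewrite -nbs1 -[t.+1]add1n -[in X in X + _](cards1 x).
by apply: expansion; rewrite ?sub1set // ?indep1 // -card_gt0 cards1.
Qed.

Lemma max_indep B :
  exists J, [/\ J \subset B, indep J & forall I, I \subset B -> indep I -> #|I| <= #|J|].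
Proof.
pose P I := (I \subset B) && indep I; have P0 : P set0.
  by rewrite /P sub0set; apply/indepP => x y; rewrite inE.
case: (arg_maxnP (fun I : {set T} => #|I|) P0) => J /andP[sJ iJ] maxJ.
by exists J; split=> // I sI iI; apply: maxJ; rewrite /P sI.
Qed.

(** Let [J] be a maximum independent subset. By exchange, an independent set outside [J] has at
    least as many neighbours in [J]; the parts of a set inside and outside [A] have disjoint
    neighbourhoods, so Hall's theorem matches everything outside [J] into [J]. A vertex isolated in
    [A :|: B] lies in [J] and forms a class of its own. *)
Lemma konig_cover A B : indep A -> indep B ->
  exists f : T -> T, [/\ clique_cover f (A :|: B), #|f @: (A :|: B)| <= 7 &
    forall c, c \in A :|: B -> {in A :|: B, forall x, ~~ h c x} ->
      f c = c /\ {in A :|: B, forall x, f x = c -> x = c}].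
Proof.
move=> iA iB; have [J [sJ iJ maxJ]] := max_indep (A :|: B).
pose r x y := h x y && (y \in J).
have exch O : O \subset A :|: B -> O \subset ~: J -> indep O -> #|O| <= #|nbhd r O|.
  move=> sO dO iO; have sNJ : nbhd r O \subset J.
    by apply/subsetP=> y /nbhdP[x _ /andP[]].
  have := maxJ (O :|: (J :\: nbhd r O)).
  rewrite subUset sO (subset_trans (subsetDl _ _) sJ) => /(_ isT).
  have iU : indep (O :|: (J :\: nbhd r O)).
    apply: indepU iO (indepS (subsetDl _ _) iJ) _ => x y xO.
    rewrite inE => /andP[+ yJ]; apply: contra => hxy.
    by apply/nbhdP; exists x; rewrite // /r hxy.
  move=> /(_ iU); rewrite cardsU cardsD (setIidPr sNJ).
  rewrite (_ : O :&: _ = set0) ?cards0; first by have := subset_leq_card sNJ; lia.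
  apply/eqP; rewrite setI_eq0; apply/pred0P=> x /=; apply/andP=> -[xO].
  by rewrite inE => /andP[_ xJ]; move: (subsetP dO _ xO); rewrite inE xJ.
have [O|f [fr finj]] := @hall_matching _ r ((A :|: B) :\: J).
  rewrite subsetD => /andP[sO dO].
  have dO' : O \subset ~: J by rewrite -disjoints_subset.
  have sOB : O :\: A \subset B.
    apply/subsetP=> x; rewrite inE => /andP[xA /(subsetP sO)].
    by rewrite inE (negbTE xA).
  have le1 : #|O :&: A| <= #|nbhd r (O :&: A)|.
    by apply: exch; rewrite ?(subset_trans (subsetIl _ _)) // (indepS (subsetIr _ _)).
  have le2 : #|O :\: A| <= #|nbhd r (O :\: A)|.
    by apply: exch; rewrite ?(subset_trans (subsetDl _ _)) // (indepS sOB).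
  have := cardsID A O; rewrite -[in nbhd r O](setID O A) nbhdU cardsU.
  rewrite (_ : nbhd r (O :&: A) :&: _ = set0) ?cards0; first lia.
  apply/eqP; rewrite setI_eq0; apply/pred0P=> y /=.
  apply/andP=> -[/nbhdP[x1 + /andP[h1 yJ]] /nbhdP[x2 x2O /andP[h2 _]]].
  rewrite inE => /andP[_ x1A].
  have := subsetP sJ _ yJ; rewrite inE => /orP[yA|yB].
    by move/indepP: iA => /(_ x1 y x1A yA); rewrite h1.
  by move/indepP: iB => /(_ x2 y (subsetP sOB _ x2O) yB); rewrite h2.
pose g x := if x \in (A :|: B) :\: J then f x else x.
have gJ x : x \in A :|: B -> g x \in J.
  rewrite /g => xAB; case: ifP => [/fr/andP[]//|].
  by rewrite inE xAB andbT => /negbFE.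
exists g; split.
- by apply: match_cover finj => x /fr/andP[].
- apply: leq_trans (alpha7 iJ); apply: subset_leq_card.
  by apply/subsetP=> _ /imsetP[x /gJ xJ ->].
- move=> c cAB ciso; have cJ : c \in J.
    apply: contraT => cnJ; have := maxJ (c |: J).
    rewrite subUset sub1set cAB sJ cardsU1 cnJ ltnn => /(_ isT) imp.
    by apply: imp; apply: indepU1 => // y yJ; apply: ciso; apply: (subsetP sJ).
  rewrite /g inE cJ /=; split=> // x xAB.
  by case: ifP => // /fr/andP[+ _] E; rewrite E hsym => /negP[]; apply/negP/ciso.
Qed.

End Alpha.
End Arrow.

(** * Matchings and augmenting paths *)

Section Matching.
Context {T : finType} (h : rel T).
Hypotheses (hsym : symmetric h) (hirr : irreflexive h).
Implicit Types (V A B C I J K O : {set T}) (x y z : T) (m : T -> T).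

(* A matching is encoded as an involution; its fixed points are the unmatched
   vertices. *)
Definition matching V m :=
  {in V, forall x, [/\ m x \in V, m (m x) = x & m x != x -> h x (m x)]}.

Definition unmatched V m : {set T} := [set x in V | m x == x].

Definition max_matching V m := matching V m /\
  forall m', matching V m' -> #|unmatched V m| <= #|unmatched V m'|.

Lemma matchingP V m : reflect (matching V m)
  [forall x in V, [&& m x \in V, m (m x) == x & (m x != x) ==> h x (m x)]].
Proof.
apply: (iffP forall_inP) => mP x /mP.
  by case/and3P=> -> /eqP-> /implyP.
by case=> -> -> hx; rewrite eqxx; apply/implyP.
Qed.

(** The minimum is taken over the finite type [{ffun T -> T}]. *)
Lemma max_matching_exists V : exists m, max_matching V m.
Proof.
pose P (f : {ffun T -> T}) := [forall x in V,
  [&& f x \in V, f (f x) == x & (f x != x) ==> h x (f x)]].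
have P0 : P [ffun x => x].
  by apply/forall_inP=> x xV; rewrite !ffunE xV eqxx.
case: (arg_minnP (fun f : {ffun T -> T} => #|unmatched V f|) P0) => f.
move/matchingP=> mf minf; exists f; split=> // m mm.
have := minf (finfun m); have -> : P (finfun m).
  by apply/matchingP=> x xV; rewrite !ffunE; apply: mm.
move/(_ isT); congr (_ <= _); apply: eq_card => x.
by rewrite !inE ffunE.
Qed.

(** The pairs are the edges of an augmenting path that enter the matching. *)
Fixpoint swap_pairs (l : seq (T * T)) x :=
  if l is (a, b) :: l' then
    if x == a then b else if x == b then a else swap_pairs l' x
  else x.

Definition ends (l : seq (T * T)) := flatten [seq [:: p.1; p.2] | p <- l].

Lemma swap_pairsP l x : uniq (ends l) -> all (fun p => h p.1 p.2) l ->
    x \in ends l ->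
  [/\ swap_pairs l x \in ends l, swap_pairs l (swap_pairs l x) = x &
      h x (swap_pairs l x)].
Proof.
elim: l => //= -[a b] l IHl /= /and3P[]; rewrite !inE negb_or => /andP[ab al bl].
move=> ul /andP[hab hl]; case: eqVneq => [->|xa] /=.
  by rewrite eqxx eq_sym (negbTE ab) orbT.
case: eqVneq => [->|xb] /= xl; first by rewrite !eqxx hsym.
have [sl ssl hs] := IHl ul hl xl; rewrite sl !orbT; split=> //.
case: eqVneq => [E|_]; first by rewrite -E sl in al.
by case: eqVneq => [E|_]; first by rewrite -E sl in bl.
Qed.

(** Rematch [ends l] by the pairs of [l] and keep [m] elsewhere. This is a matching because [ends l]
    is closed under [m]; it covers [z] and uncovers nothing. *)
Lemma no_augmentation V m l z : max_matching V m ->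
    uniq (ends l) -> all (fun p => h p.1 p.2) l -> {subset ends l <= V} ->
    {in ends l, forall x, m x \in ends l} ->
  z \in ends l -> m z <> z.
Proof.
move=> [mm maxm] ul hl sl cl zl mz.
pose m' x := if x \in ends l then swap_pairs l x else m x.
have mm' : matching V m'.
  move=> x xV; rewrite /m'; case: ifP => xl.
    have [sxl ssx hsx] := swap_pairsP ul hl xl.
    by rewrite sxl ssx (sl _ sxl).
  have [mxV mmx hmx] := mm x xV; case: ifP => mxl; last by [].
  by have := cl _ mxl; rewrite mmx xl.
have := maxm m' mm'; rewrite leqNgt => /negP[].
apply: proper_card; apply/properP; split.
  apply/subsetP=> x; rewrite !inE /m' => /andP[->] /=; case: ifP => // xl.
  have [_ _ hsx] := swap_pairsP ul hl xl; move/eqP=> E.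
  by rewrite E hirr in hsx.
exists z; rewrite !inE ?sl ?mz ?eqxx //= /m' zl.
have [_ _ hsz] := swap_pairsP ul hl zl.
by apply: contraTN hsz => /eqP->; rewrite hirr.
Qed.

Section MatchingTheory.
Variables (V : {set T}) (m : T -> T).
Hypothesis mm : matching V m.

Lemma matchingK x : x \in V -> m (m x) = x. Proof. by case/mm. Qed.
Lemma matching_in x : x \in V -> m x \in V. Proof. by case/mm. Qed.
Lemma matching_adj x : x \in V -> m x != x -> h x (m x). Proof. by case/mm. Qed.
Lemma matching_inj : {in V &, injective m}.
Proof. by move=> x y xV yV E; rewrite -(matchingK xV) E matchingK. Qed.

End MatchingTheory.

Section MaxMatching.
Variables (V : {set T}) (m : T -> T).
Hypothesis maxm : max_matching V m.
Let mm : matching V m := proj1 maxm.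

Lemma unmatchedP z : reflect (z \in V /\ m z = z) (z \in unmatched V m).
Proof. by rewrite inE; apply: (iffP andP) => -[-> /eqP]. Qed.

Lemma moved_neq a z : m z = z -> m a != a -> z != a.
Proof. by move=> mz; apply: contraNneq => <-; rewrite mz. Qed.

(** In [augment1], [augment3], [augment5] and [augment7] the number is the length in edges of the
    augmenting path from [z1] to [z2] that is excluded. *)
Lemma augment1 z1 z2 : z1 \in unmatched V m -> z2 \in unmatched V m -> ~~ h z1 z2.
Proof.
move=> /unmatchedP[z1V mz1] /unmatchedP[z2V mz2]; apply/negP=> h12.
apply: (@no_augmentation V m [:: (z1, z2)] z1) => //=; last by rewrite inE eqxx.
- by rewrite !inE andbT; apply: contraTN h12 => /eqP->; rewrite hirr.
- by rewrite h12.
- by move=> x; rewrite !inE => /orP[] /eqP->.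
- by move=> x; rewrite !inE => /orP[] /eqP->; rewrite ?mz1 ?mz2 eqxx ?orbT.
Qed.

Lemma nb_unmatched z u : z \in unmatched V m -> u \in nb h V z -> m u != u.
Proof.
move=> zZ; rewrite in_nb => /andP[uV]; apply: contraTneq => mu.
by apply: augment1 => //; apply/unmatchedP.
Qed.

Lemma augment3 z1 z2 u : z1 \in unmatched V m -> z2 \in unmatched V m -> z1 != z2 ->
  u \in nb h V z1 -> ~~ h (m u) z2.
Proof.
move=> z1Z z2Z z12 uN; have mu := nb_unmatched z1Z uN; apply/negP=> h2.
move: z1Z z2Z uN => /unmatchedP[z1V mz1] /unmatchedP[z2V mz2].
rewrite in_nb => /andP[uV h1].
apply: (@no_augmentation V m [:: (z1, u); (m u, z2)] z1) => //=;
  last by rewrite inE eqxx.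
- have mmu : m (m u) != m u by rewrite (matchingK mm) // eq_sym.
  have [z1u z1u'] := (moved_neq mz1 mu, moved_neq mz1 mmu).
  have [z2u z2u'] := (moved_neq mz2 mu, moved_neq mz2 mmu).
  by rewrite !inE !negb_or; do ?[apply/andP; split]; rewrite // eq_sym.
- by rewrite h1 h2.
- by move=> x; rewrite !inE => /or4P[] /eqP-> //; apply: (matching_in mm).
- by move=> x; rewrite !inE => /or4P[] /eqP->; rewrite ?mz1 ?mz2 ?(matchingK mm) ?eqxx ?orbT.
Qed.

Lemma augment5 z1 z2 u1 u2 : z1 \in unmatched V m -> z2 \in unmatched V m -> z1 != z2 ->
  u1 \in nb h V z1 -> u2 \in nb h V z2 -> ~~ h (m u1) (m u2).
Proof.
move=> z1Z z2Z z12 u1N u2N; have mu1 := nb_unmatched z1Z u1N.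
have mu2 := nb_unmatched z2Z u2N; apply/negP=> h12.
have := augment3 z1Z z2Z z12 u1N.
move: z1Z z2Z u1N u2N => /unmatchedP[z1V mz1] /unmatchedP[z2V mz2].
rewrite !in_nb => /andP[u1V h1] /andP[u2V h2] h1'.
have u12 : u1 != u2 by apply: contraTneq h12 => ->; rewrite hirr.
have u12' : m u1 != u2 by apply: contraNneq h1' => ->; rewrite hsym.
apply: (@no_augmentation V m [:: (z1, u1); (m u1, m u2); (u2, z2)] z1) => //=;
  last by rewrite inE eqxx.
- have mmu1 : m (m u1) != m u1 by rewrite (matchingK mm) // eq_sym.
  have mmu2 : m (m u2) != m u2 by rewrite (matchingK mm) // eq_sym.
  have [z1u z1u'] := (moved_neq mz1 mu1, moved_neq mz1 mmu1).
  have [z2u z2u'] := (moved_neq mz2 mu1, moved_neq mz2 mmu1).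
  have [z1w z1w'] := (moved_neq mz1 mu2, moved_neq mz1 mmu2).
  have [z2w z2w'] := (moved_neq mz2 mu2, moved_neq mz2 mmu2).
  have u12'' : u1 != m u2.
    by rewrite -(inj_in_eq (matching_inj mm)) ?(matching_in mm) // (matchingK mm).
  have u12''' : m u1 != m u2 by rewrite (inj_in_eq (matching_inj mm)).
  by rewrite !inE !negb_or; do ?[apply/andP; split]; rewrite // eq_sym.
- by rewrite h1 h12 hsym h2.
- by move=> x; rewrite !inE => /or4P[| | |/or3P[]] /eqP-> //; apply: (matching_in mm).
- move=> x; rewrite !inE => /or4P[| | |/or3P[]] /eqP->;
    by rewrite ?mz1 ?mz2 ?(matchingK mm) ?eqxx ?orbT.
Qed.

(** The path is [z1], [u1], [m u1], [p], [m p], [m u2], [u2], [z2]. *)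
Lemma augment7 z1 z2 u1 u2 p : z1 \in unmatched V m -> z2 \in unmatched V m -> z1 != z2 ->
    u1 \in nb h V z1 -> u2 \in nb h V z2 -> u1 != u2 ->
    p \in V -> m p != p -> p \notin [:: u1; m u1; u2; m u2] ->
  ~~ (h (m u1) p && h (m p) (m u2)).
Proof.
move=> z1Z z2Z z12 u1N u2N u12 pV mp; have mu1 := nb_unmatched z1Z u1N.
have mu2 := nb_unmatched z2Z u2N; have := augment3 z1Z z2Z z12 u1N.
move: z1Z z2Z u1N u2N => /unmatchedP[z1V mz1] /unmatchedP[z2V mz2].
rewrite !in_nb => /andP[u1V h1] /andP[u2V h2] h1'.
rewrite !inE !negb_or => /and4P[p1 p1' p2 p2']; apply/negP=> /andP[hp1 hp2].
have u12' : m u1 != u2 by apply: contraNneq h1' => ->; rewrite hsym.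
apply: (@no_augmentation V m [:: (z1, u1); (m u1, p); (m p, m u2); (u2, z2)] z1) => //=;
  last by rewrite inE eqxx.
- have mmu1 : m (m u1) != m u1 by rewrite (matchingK mm) // eq_sym.
  have mmu2 : m (m u2) != m u2 by rewrite (matchingK mm) // eq_sym.
  have mmp : m (m p) != m p by rewrite (matchingK mm) // eq_sym.
  have [z1u z1u'] := (moved_neq mz1 mu1, moved_neq mz1 mmu1).
  have [z2u z2u'] := (moved_neq mz2 mu1, moved_neq mz2 mmu1).
  have [z1w z1w'] := (moved_neq mz1 mu2, moved_neq mz1 mmu2).
  have [z2w z2w'] := (moved_neq mz2 mu2, moved_neq mz2 mmu2).
  have [z1p z1p'] := (moved_neq mz1 mp, moved_neq mz1 mmp).
  have [z2p z2p'] := (moved_neq mz2 mp, moved_neq mz2 mmp).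
  have E x y : x \in V -> y \in V -> x != y -> m x != m y.
    by move=> xV yV; rewrite (inj_in_eq (matching_inj mm)).
  have E' x y : x \in V -> y \in V -> x != m y -> m x != y.
    by move=> xV yV xy; rewrite -(matchingK mm yV); apply: E => //; apply: (matching_in mm).
  have u12'' := E _ _ u1V u2V u12.
  have [q1 q1'] := (E' _ _ pV u1V p1', E _ _ pV u1V p1).
  have [q2 q2'] := (E' _ _ pV u2V p2', E _ _ pV u2V p2).
  have u21 : u1 != m u2 by rewrite eq_sym E' // eq_sym.
  by rewrite !inE !negb_or; do ?[apply/andP; split]; rewrite // eq_sym.
- by rewrite h1 hp1 hp2 hsym h2.
- by move=> x; rewrite !inE => /or4P[| | |/or4P[| | |/orP[]]] /eqP-> //; apply: (matching_in mm).
- move=> x; rewrite !inE => /or4P[| | |/or4P[| | |/orP[]]] /eqP->;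
    by rewrite ?mz1 ?mz2 ?(matchingK mm) ?eqxx ?orbT.
Qed.

End MaxMatching.
End Matching.

(** * Triangle-free complements *)

(** Arithmetic for [blossom], with [d], [p], [r] the sizes of [U], [P], [R] there. Order 20 is
    impossible, and order 18 leaves a single tight case. *)
Lemma blossom_count20 d p r : r + 2 * d = 20 -> 4 <= d <= 6 -> r <= 2 * p ->
  2 * p <= (6 - d) * (6 - d + 3) -> False.
Proof. by case: d => [|[|[|[|[|[|[|d]]]]]]] //=; lia. Qed.

Lemma blossom_count18 d p r : r + 2 * d = 18 -> 4 <= d <= 6 -> r <= 2 * p ->
  2 * p <= (6 - d) * (6 - d + 3) -> d = 4 /\ p = 5.
Proof. by case: d => [|[|[|[|[|[|[|d]]]]]]] //=; lia. Qed.

Section TriangleFree.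
Context {T : finType} (h : rel T).
Hypotheses (hsym : symmetric h) (hirr : irreflexive h).
Hypothesis alpha7 : forall I : {set T}, indep h I -> #|I| <= 7.
Implicit Types (V A B C I J K O P : {set T}) (x y z : T) (m : T -> T).

Definition triangle_free V := {in V, forall x, indep h (nb h V x)}.

Lemma triangle_freeN V x y z : triangle_free V -> x \in V -> y \in V -> z \in V ->
  h x y -> h x z -> ~~ h y z.
Proof.
move=> tfV xV yV zV hxy hxz; move/indepP: (tfV x xV); apply; rewrite in_nb ?yV ?zV //.
Qed.

(** This is the Ramsey bound [R(3, a + 1) <= (a + 1)(a + 2) / 2]. Deleting a vertex and its
    neighbours, which form an independent set, lowers the bound on independent sets by one. *)
Lemma triangle_free_card V P a : triangle_free V -> P \subset V ->
    (forall I, I \subset P -> indep h I -> #|I| <= a) ->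
  2 * #|P| <= a * (a + 3).
Proof.
move=> tfV; elim: a P => [|a IHa] P sPV bnd.
  have [->|[x xP]] := set_0Vmem P; first by rewrite cards0.
  by have := bnd [set x]; rewrite sub1set xP indep1 // cards1 => /(_ isT isT).
have [->|[x xP]] := set_0Vmem P; first by rewrite cards0.
have xV := subsetP sPV _ xP.
have le1 : #|nb h P x| <= a.+1.
  apply: bnd; first exact: nb_sub.
  apply: indepS (tfV x xV); apply/subsetP=> y.
  by rewrite !in_nb => /andP[/(subsetP sPV)-> ->].
have sP' : P :\: (x |: nb h P x) \subset V := subset_trans (subsetDl _ _) sPV.
have le2 := IHa _ sP' _; have := cardsID (x |: nb h P x) P.
rewrite (setIidPr _); last by rewrite subUset sub1set xP nb_sub.
rewrite cardsU1 in_nb hirr andbF /=.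
suff : 2 * #|P :\: (x |: nb h P x)| <= a * (a + 3) by nia.
apply: le2 => I sI iI; rewrite -ltnS.
have xI : x \notin I by apply/negP=> /(subsetP sI); rewrite !inE eqxx.
have -> : #|I|.+1 = #|x |: I| by rewrite cardsU1 xI.
apply: bnd.
  by rewrite subUset sub1set xP (subset_trans sI) // subsetDl.
apply: indepU1 => // y /(subsetP sI); rewrite !inE negb_or => /andP[/andP[_]].
by rewrite negb_and; case: (y \in P).
Qed.

(** * Matching edges as the cliques of a cover *)

Section Pairs.
Variables (V : {set T}) (m : T -> T).
Hypothesis mm : matching h V m.

Definition pr x : {set T} := [set x; m x].

Definition closed_under K := {in K, forall x, m x \in K}.

Lemma pr_eq x y : x \in V -> y \in V -> pr x = pr y -> x = y \/ m x = y.
Proof.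
move=> xV yV E; have : x \in pr y by rewrite -E !inE eqxx.
by rewrite !inE => /orP[] /eqP->; [left|right; apply: (matchingK mm)].
Qed.

Lemma pr_cover B : B \subset V -> clique_cover h pr B.
Proof.
move=> /subsetP sBV x y /sBV xV /sBV yV /(pr_eq xV yV)[->|<-]; first by rewrite eqxx.
by rewrite eq_sym; apply: (matching_adj mm).
Qed.

Lemma card_pr B : B \subset V -> closed_under B -> {in B, forall x, m x != x} ->
  2 * #|pr @: B| = #|B|.
Proof.
move=> sBV clB nf; rewrite -[RHS]sum1_card (partition_big_imset pr) /= mulnC.
rewrite -sum_nat_const; apply: eq_bigr => _ /imsetP[x xB ->].
have xV := subsetP sBV _ xB.
rewrite sum1dep_card (_ : [set _ | _] = [set x; m x]).
  by rewrite cards2 eq_sym nf.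
apply/setP=> y; rewrite !inE; apply/andP/orP.
  case=> yB /eqP E; have yV := subsetP sBV _ yB.
  by case: (pr_eq xV yV (esym E)) => ->; rewrite eqxx; [left|right].
case=> /eqP->; first by rewrite xB.
by rewrite clB // /pr (matchingK mm) // setUC.
Qed.

(** [I] has at most one vertex in each [pr x], so with this many vertices it meets all of them. *)
Lemma pr_transversal K I : K \subset V -> I \subset K -> indep h I ->
  #|pr @: K| <= #|I| -> {in K, forall x, x \in I \/ m x \in I}.
Proof.
move=> sKV sIK iI; rewrite (indep_inj (pr_cover sKV) sIK iI) => le x xK.
have E : pr @: I = pr @: K by apply/eqP; rewrite eqEcard le imsetS.
have : pr x \in pr @: I by rewrite E imset_f.
case/imsetP=> y yI Exy; have yK := subsetP sIK _ yI.
by case: (pr_eq (subsetP sKV _ xK) (subsetP sKV _ yK) Exy) => ->; [left|right].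
Qed.

Lemma indep_card_pr K I : K \subset V -> I \subset K -> indep h I ->
  #|I| <= #|pr @: K|.
Proof.
move=> sKV sIK iI; rewrite (indep_inj (pr_cover sKV) sIK iI).
by apply: subset_leq_card; apply: imsetS.
Qed.

(* [K] is a union of matching edges, and no independent set containing [y] meets
   all of them. *)
Definition blocks K y := [/\ K \subset V, closed_under K &
  forall I, indep h I -> y \in I -> ~ {in K, forall x, x \in I \/ m x \in I}].

(** If [y] is in [I], then [I] misses a matching edge of [K], which makes up for [y]. *)
Lemma blocks_card K y I : blocks K y -> indep h I -> y \notin K ->
  #|I :&: (y |: K)| <= #|pr @: K|.
Proof.
move=> [sKV clK blK] iI yK.
have iIK : indep h (I :&: K) by apply: indepS iI; apply: subsetIl.
have sIK : I :&: K \subset K by apply: subsetIr.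
have [yI|yI] := boolP (y \in I); last first.
  rewrite setIUr (_ : I :&: [set y] = set0) ?set0U; first exact: indep_card_pr.
  by apply/setP=> z; rewrite !inE andbC; case: eqVneq => // ->; rewrite (negbTE yI).
rewrite setIUr (setIidPr _) ?sub1set // cardsU1 inE (negbTE yK) andbF add1n ltnNge.
apply/negP=> /(pr_transversal sKV sIK iIK) tr; apply: (blK I) => // x xK.
by case: (tr x xK) => /setIP[]; [left|right].
Qed.

Hypothesis tfV : triangle_free V.

(* An independent set containing [y] and meeting every matching edge avoids the
   neighbours [U] of [y], so it contains their partners [X]. This is impossible if
   [X] contains an edge or if both ends of some matching edge have neighbours in
   [X]. Otherwise the vertices outside [U] with no neighbour in [X] form a set [P]
   meeting every remaining edge, and [alpha7] bounds [P] through the Ramsey bound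
   [triangle_free_card]. *)
Lemma blossom y : y \in V ->
    {in V :\: pr y, forall x, m x != x} ->
    4 <= #|nb h V y :\ m y| -> #|V :\: pr y| = 18 \/ #|V :\: pr y| = 20 ->
  exists K, [/\ blocks K y, K \subset V :\: pr y &
                #|K| <= 6 \/ #|K| <= 8 /\ #|V :\: pr y| = 18].
Proof.
move=> yV nf degy cardV'; pose V' := V :\: pr y; pose U := nb h V y :\ m y.
pose X := m @: U.
have V'P x : reflect [/\ x \in V, x != y & x != m y] (x \in V').
  by rewrite !inE negb_or andbC; apply: (iffP and3P).
have VV' x : x \in V' -> x \in V by case/V'P.
have V'm x : x \in V' -> m x \in V'.
  case/V'P=> xV xy xmy; apply/V'P; rewrite (matching_in mm) //; split=> //.
    by apply: contraNneq xmy => <-; rewrite (matchingK mm).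
  by apply: contraNneq xy => /(matching_inj mm)-> //.
have UP u : u \in U -> [/\ u \in V', u \in V & h y u].
  rewrite in_setD1 in_nb => /and3P[um uV hyu]; split=> //.
  by apply/V'P; split=> //; apply: contraTneq hyu => ->; rewrite hirr.
have adjm u : u \in V' -> h u (m u).
  by move=> uV'; apply: (matching_adj mm); [case/V'P: uV'|apply: nf].
have XP x : x \in X -> exists u, [/\ u \in U, x = m u, x \in V', m x = u & ~~ h y x].
  case/imsetP=> u uU ->; have [uV' uV hyu] := UP u uU; exists u.
  split; rewrite ?V'm ?(matchingK mm) //.
  apply: (triangle_freeN tfV uV) => //; first exact: (matching_in mm).
    by rewrite hsym.
  exact: adjm.
have mkK s : all (mem V') s -> {in s, forall x, m x \in s} ->
    (forall I, indep h I -> y \in I -> {in s, forall x, x \in I \/ m x \in I} -> False) ->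
    blocks [set x in s] y /\ [set x in s] \subset V'.
  move=> /allP sV' sm sI; have sub : [set x in s] \subset V'.
    by apply/subsetP=> x; rewrite inE; apply: sV'.
  split=> //; split; first exact: subset_trans sub (subsetDl _ _).
    by move=> x; rewrite !inE; apply: sm.
  move=> I iI yI tr; apply: (sI I) => // x xs; apply: tr.
  by rewrite inE.
have forceX I x : indep h I -> y \in I -> x \in X -> x \in I \/ m x \in I -> x \in I.
  move=> /indepP iI yI /XP[u [/UP[_ _ hyu] -> _ -> _]] [//|uI].
  by have := iI y u yI uI; rewrite hyu.
have [/exists_inP[x1 x1X /exists_inP[x2 x2X h12]]|] :=
    boolP [exists x1 in X, exists x2 in X, h x1 x2].
  have [u1 [u1U _ x1V' mx1 _]] := XP _ x1X; have [u2 [u2U _ x2V' mx2 _]] := XP _ x2X.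
  have [||I iI yI tr|bl sub] := mkK [:: x1; m x1; x2; m x2].
  - by rewrite /= x1V' x2V' !V'm.
  - move=> x; rewrite !inE => /or4P[] /eqP->;
      by rewrite ?(matchingK mm) ?eqxx ?orbT ?VV'.
  - have x1I : x1 \in I by apply: (forceX I) => //; apply: tr; rewrite !inE eqxx.
    have x2I : x2 \in I by apply: (forceX I) => //; apply: tr; rewrite !inE eqxx ?orbT.
    by move/indepP: iI => /(_ x1 x2 x1I x2I); rewrite h12.
  exists [set x in [:: x1; m x1; x2; m x2]]; split=> //; left.
  by rewrite cardsE; apply: leq_trans (card_size _) _.
rewrite negb_exists_in => /forall_inP nbX.
have iX : indep h X.
  apply/indepP=> x1 x2 x1X x2X; have := nbX x1 x1X.
  by rewrite negb_exists_in => /forall_inP/(_ x2 x2X).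
have iS : indep h (y |: X) by apply: indepU1 => // x /XP[u []].
have yX : y \notin X by apply/negP=> /XP[u [_ _ /V'P[_ /eqP]]].
have cX : #|X| = #|U|.
  by apply: card_in_imset => u v /UP[_ uV _] /UP[_ vV _]; apply: (matching_inj mm).
pose R := V' :\: (U :|: X).
have dUX : [disjoint U & X].
  apply/pred0P=> x /=; apply/andP=> -[/UP[_ _ hyx] /XP[u [_ _ _ _]]].
  by rewrite hyx.
have cR : #|R| + 2 * #|U| = #|V'|.
  have := cardsID (U :|: X) V'; rewrite (setIidPr _); last first.
    by rewrite subUset; apply/andP; split; apply/subsetP=> x; [case/UP|case/XP=> u []].
  rewrite -/R cardsU (_ : U :&: X = set0) ?cards0 ?cX; first lia.
  by apply/eqP; rewrite setI_eq0.
have RP p : p \in R -> [/\ p \in V', p \in V, p \notin U & p \notin X].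
  rewrite in_setD in_setU negb_or => /andP[/andP[-> ->] pV'].
  by case/V'P: (pV').
have Rm p : p \in R -> m p \in R.
  case/RP=> pV' pV pU pX; rewrite in_setD in_setU negb_or V'm // andbT.
  apply/andP; split.
    by apply: contra pX => mpU; apply/imsetP; exists (m p); rewrite ?(matchingK mm).
  apply: contra pU => /imsetP[u uU]; have [_ uV _] := UP u uU.
  by move/(matching_inj mm)=> ->.
pose P := [set p in R | [forall x in X, ~~ h p x]].
have notP p : p \in R -> p \notin P -> exists2 x, x \in X & h p x.
  move=> pR; rewrite inE pR negb_forall_in /= => /exists_inP[x xX /negPn hpx].
  by exists x.
have [/exists_inP[p pR /andP[pP mpP]]|] :=
    boolP [exists p in R, (p \notin P) && (m p \notin P)].
  have [x1 x1X h1] := notP p pR pP; have [x2 x2X h2] := notP _ (Rm p pR) mpP.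
  have [u1 [u1U _ x1V' mx1 _]] := XP _ x1X; have [u2 [u2U _ x2V' mx2 _]] := XP _ x2X.
  have [pV' pV _ _] := RP p pR.
  have [||I iI yI tr|bl sub] := mkK [:: x1; m x1; x2; m x2; p; m p].
  - by rewrite /= x1V' x2V' pV' !V'm.
  - move=> x; rewrite !inE => /or4P[| | |/or3P[]] /eqP->;
      by rewrite ?(matchingK mm) ?eqxx ?orbT ?VV'.
  - have x1I : x1 \in I by apply: (forceX I) => //; apply: tr; rewrite !inE eqxx.
    have x2I : x2 \in I by apply: (forceX I) => //; apply: tr; rewrite !inE eqxx ?orbT.
    move/indepP: iI => iI; have [|pI|pI] := tr p; first by rewrite !inE eqxx !orbT.
      by have := iI _ _ pI x1I; rewrite h1.
    by have := iI _ _ pI x2I; rewrite h2.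
  exists [set x in [:: x1; m x1; x2; m x2; p; m p]]; split=> //; left.
  by rewrite cardsE; apply: leq_trans (card_size _) _.
rewrite negb_exists_in => /forall_inP pairP.
have sRP : R \subset P :|: m @: P.
  apply/subsetP=> p pR; have := pairP p pR; rewrite in_setU negb_and !negbK.
  case/orP=> [->//|mpP]; have [_ pV _ _] := RP p pR.
  by apply/orP; right; apply/imsetP; exists (m p); rewrite ?(matchingK mm).
have sPR : P \subset R by apply/subsetP=> p; rewrite inE => /andP[].
have cS : #|U| <= 6.
  by have := alpha7 iS; rewrite cardsU1 yX cX add1n.
(* Adding the [#|U| + 1] vertices of [y |: X] to [I] keeps it independent. *)
have bndP I : I \subset P -> indep h I -> #|I| <= 6 - #|U|.
  move=> sIP iI; suff : #|I :|: (y |: X)| <= 7.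
    rewrite cardsU (_ : I :&: (y |: X) = set0) ?cards0 ?cardsU1 ?yX ?cX; first lia.
    apply/eqP; rewrite setI_eq0; apply/pred0P=> p /=; apply/andP=> -[].
    move=> /(subsetP sIP)/(subsetP sPR)/RP[pV' _ _ pX]; rewrite in_setU1 (negbTE pX).
    by case/V'P: pV' => _ /negbTE->.
  apply: alpha7; apply: indepU => // p x /(subsetP sIP); rewrite inE => /andP[pR nX].
  case/setU1P=> [->|]; last exact: (forall_inP nX).
  have [/V'P[pV _ pmy] _ pU _] := RP p pR; apply: contra pU => hpy.
  by rewrite in_setD1 pmy in_nb pV hsym.
have sPV : P \subset V by apply/subsetP=> p /(subsetP sPR)/RP[].
have le1 := triangle_free_card tfV sPV bndP.
have le2 : #|R| <= #|P :|: m @: P| := subset_leq_card sRP.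
have le3 : #|m @: P| <= #|P| := leq_imset_card _ _.
have cPU := cardsUI P (m @: P).
have degU : 4 <= #|U| <= 6 by rewrite degy.
have le4 : #|R| <= 2 * #|P|.
  by apply: leq_trans le2 _; rewrite mul2n -addnn (leq_trans (leq_card_setU _ _)) ?leq_add2l.
rewrite -/V' in cardV' *; have {cardV'}cV' : #|V'| = 18.
  by case: cardV' => // cV'; rewrite cV' in cR; case: (blossom_count20 cR degU le4 le1).
rewrite cV' in cR *; have [dU cP] := blossom_count18 cR degU le4 le1.
rewrite dU in cR.
(* Here [#|R| = 10] and [#|P| = 5], so each edge of [R] has exactly one end in [P]. *)
have /eqP : #|P :&: m @: P| = 0 by clear -cPU le2 le3 cR cP; lia.
rewrite cards_eq0 => /eqP dP.
(* The five vertices of [P] contain no independent 3-set, hence they span an edge. *)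
have [/exists_inP[p1 p1P /exists_inP[p2 p2P h12]]|] :=
    boolP [exists p1 in P, exists p2 in P, h p1 p2]; last first.
  rewrite negb_exists_in => /forall_inP nP; have iP : indep h P.
    apply/indepP=> p1 p2 p1P p2P; have := nP p1 p1P.
    by rewrite negb_exists_in => /forall_inP/(_ p2 p2P).
  by have := bndP P (subxx _) iP; rewrite dU cP.
(* So [m p] is excluded and [p] forced, for [p1] and [p2] alike; being adjacent, they give a block
   of four edges. *)
have mP p : p \in P -> exists2 x, x \in X & h (m p) x.
  move=> pP; apply: notP; first by apply: Rm; apply: (subsetP sPR).
  by apply/negP=> mpP; have := in_set0 (m p); rewrite -dP inE mpP imset_f.
have [[x1 x1X h1] [x2 x2X h2]] := (mP _ p1P, mP _ p2P).
have [u1 [u1U _ x1V' mx1 _]] := XP _ x1X; have [u2 [u2U _ x2V' mx2 _]] := XP _ x2X.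
have [p1V' p1V _ _] := RP _ (subsetP sPR _ p1P).
have [p2V' p2V _ _] := RP _ (subsetP sPR _ p2P).
have [||I iI yI tr|bl sub] := mkK [:: x1; m x1; x2; m x2; p1; m p1; p2; m p2].
- by rewrite /= x1V' x2V' p1V' p2V' !V'm.
- move=> x; rewrite !inE => /or4P[| | |/or4P[| | |/orP[]]] /eqP->;
    by rewrite ?(matchingK mm) ?eqxx ?orbT ?VV'.
- have x1I : x1 \in I by apply: (forceX I) => //; apply: tr; rewrite !inE eqxx.
  have x2I : x2 \in I by apply: (forceX I) => //; apply: tr; rewrite !inE eqxx ?orbT.
  move/indepP: iI => iI.
  have p1I : p1 \in I.
    have [|//|pI] := tr p1; first by rewrite !inE eqxx !orbT.
    by have := iI _ _ pI x1I; rewrite h1.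
  have p2I : p2 \in I.
    have [|//|pI] := tr p2; first by rewrite !inE eqxx !orbT.
    by have := iI _ _ pI x2I; rewrite h2.
  by have := iI _ _ p1I p2I; rewrite h12.
exists [set x in [:: x1; m x1; x2; m x2; p1; m p1; p2; m p2]]; split=> //; right.
by split=> //; rewrite cardsE; apply: leq_trans (card_size _) _.
Qed.

End Pairs.
End TriangleFree.

(** * Triangle-free graphs of orders 19 and 22 *)

Section SmallTriangleFree.
Context {T : finType} (h : rel T).
Hypotheses (hsym : symmetric h) (hirr : irreflexive h).
Hypothesis alpha7 : forall I : {set T}, indep h I -> #|I| <= 7.
Implicit Types (V A B C I J K O P : {set T}) (x y z : T) (m : T -> T).

Lemma cards_unmatched V m : matching h V m ->
  2 * #|pr m @: (V :\: unmatched V m)| + #|unmatched V m| = #|V|.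
Proof.
move=> mm; have sZ : unmatched V m \subset V by apply/subsetP=> x; rewrite inE => /andP[].
rewrite (card_pr mm) ?subsetDl //.
- by rewrite -[RHS](cardsID (unmatched V m)) (setIidPr sZ) addnC.
- move=> x; rewrite !inE negb_and => /andP[+ xV]; rewrite xV /= => mx.
  by rewrite (matching_in mm) // (matchingK mm) // eq_sym mx.
- by move=> x; rewrite !inE negb_and => /andP[+ xV]; rewrite xV.
Qed.

(* For unmatched [z] let [X z] be the set of partners of the neighbours of [z].
   Without augmenting paths there are no edges between different [X z]. If some
   [X z1] is independent, the unmatched vertices and [X z1] form an independent
   7-set, from which a longer augmenting path is found; otherwise every unmatched
   vertex lies on an alternating 5-cycle, and two such cycles contain few
   independent vertices. *)
Lemma max_matching_unmatched V m t : triangle_free h V -> arr h V t ->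
    t = 3 /\ #|V| = 19 \/ t = 4 /\ #|V| = 22 -> max_matching h V m ->
  #|unmatched V m| <= 1.
Proof.
move=> tfV arrV cases maxm; have mm : matching h V m := proj1 maxm.
set Z := unmatched V m; rewrite leqNgt; apply/negP=> Z1.
have t0 : 0 < t by case: cases => -[-> _].
have ZP z : z \in Z -> z \in V /\ m z = z by move/unmatchedP.
have NV z u : u \in nb h V z -> u \in V by rewrite in_nb => /andP[].
have Nh z u : u \in nb h V z -> h z u by rewrite in_nb => /andP[].
have nfix z u : z \in Z -> u \in nb h V z -> m u != u.
  exact: (nb_unmatched hsym hirr maxm).
have adjm u z : z \in Z -> u \in nb h V z -> h u (m u).
  by move=> zZ uN; rewrite (matching_adj mm) ?(NV _ _ uN) ?(nfix z).
have mV z u : u \in nb h V z -> m u \in V by move/NV/(matching_in mm).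
have Zx z z' u : z \in Z -> z' \in Z -> u \in nb h V z -> ~~ h (m u) z'.
  move=> zZ z'Z uN; have [<-|zz'] := eqVneq z z'; last exact: (augment3 hsym hirr maxm zZ).
  apply: (triangle_freeN tfV (NV _ _ uN)); rewrite ?(mV _ _ uN) //.
  - by case: (ZP _ zZ).
  - exact: adjm uN.
  - by rewrite hsym (Nh _ _ uN).
have iZ : indep h Z by apply/indepP=> z z'; apply: (augment1 hsym hirr maxm).
have ZX z u : z \in Z -> u \in nb h V z -> m u \notin Z.
  move=> zZ uN; apply/negP=> /ZP[_]; rewrite (matchingK mm) ?(NV _ _ uN) // => E.
  by have := nfix z u zZ uN; rewrite -E eqxx.
have deg z : z \in Z -> t < #|nb h V z|.
  by case/ZP=> zV _; apply: (arr_min_degree hsym hirr alpha7).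
have cZ := cards_unmatched mm; rewrite -/Z in cZ.
pose X z := m @: nb h V z.
have [/exists_inP[z1 z1Z iX1]|] := boolP [exists z in Z, indep h (X z)].
  pose S := Z :|: X z1; have cX1 : #|X z1| = #|nb h V z1|.
    by apply: card_in_imset => u v /NV uV /NV vV; apply: (matching_inj mm).
  have iS : indep h S.
    apply: indepU => // z _ zZ /imsetP[u uN ->].
    by rewrite hsym; apply: (Zx z1).
  have cS : #|S| = #|Z| + #|nb h V z1|.
    rewrite cardsU cX1 (_ : Z :&: X z1 = set0) ?cards0 ?subn0 //.
    apply/eqP; rewrite setI_eq0; apply/pred0P=> x /=; apply/andP=> -[xZ].
    by case/imsetP=> u uN E; have := ZX _ _ z1Z uN; rewrite -E xZ.
  (* [#|Z|] has the parity of [#|V|], so it is at least 3 for order 19 and at least 2 for order 22;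
     either way [#|Z| + t + 1 >= 7], and all bounds are tight. *)
  have [S7 cN1] : #|S| = 7 /\ #|nb h V z1| = t.+1.
    have := alpha7 iS; have := deg z1 z1Z; rewrite cS.
    by clear -cases cZ Z1; lia.
  have maxS x : {in S, forall s, ~~ h x s} -> x \in S.
    move=> nxS; apply: contraT => xS; have := alpha7 (indepU1 hsym hirr iS nxS).
    by rewrite cardsU1 xS S7.
  (* The partner of a neighbour of [z] has no neighbour in the maximum set [S], hence lies in
     [X z1]. *)
  have sN z : z \in Z -> nb h V z \subset nb h V z1.
    move=> zZ; have [->//|zz1] := eqVneq z z1; apply/subsetP=> u uN.
    have : m u \in S.
      apply: maxS => s /setUP[sZ|/imsetP[u1 u1N ->]]; first exact: (Zx z).
      exact: (augment5 hsym hirr maxm zZ z1Z).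
    rewrite in_setU (negbTE (ZX _ _ zZ uN)) /= => /imsetP[u1 u1N].
    by move/(matching_inj mm)=> -> //; [apply: NV uN|apply: NV u1N].
  have /card_gt0P[z2 /setD1P[z21 z2Z]] : 0 < #|Z :\ z1|.
    by move: Z1; rewrite (cardsD1 z1) z1Z.
  have N12 : nb h V z2 = nb h V z1.
    by apply/eqP; rewrite eqEcard sN // cN1 deg.
  pose R := V :\: (Z :|: nb h V z1 :|: X z1).
  have /card_gt0P[p pR] : 0 < #|R|.
    have := cardsID (Z :|: nb h V z1 :|: X z1) V; rewrite -/R.
    have := subset_leq_card (subsetIr V (Z :|: nb h V z1 :|: X z1)).
    have := leq_of_leqif (leq_card_setU (Z :|: nb h V z1) (X z1)).
    have := leq_of_leqif (leq_card_setU Z (nb h V z1)).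
    rewrite cX1; move: S7; rewrite cS cN1.
    by clear -cases; lia.
  have RP q : q \in R -> [/\ q \in V, q \notin Z, q \notin nb h V z1 & q \notin X z1].
    by rewrite in_setD !in_setU !negb_or => /andP[/andP[/andP[-> ->] ->] ->].
  have [pV pZ pN pX] := RP p pR.
  have mp : m p != p by apply: contra pZ => /eqP E; apply/unmatchedP.
  have mpR : m p \in R.
    rewrite in_setD !in_setU !negb_or (matching_in mm) // andbT -andbA.
    apply/and3P; split.
    - by apply: contra mp => /ZP[_]; rewrite (matchingK mm) // => {1}<-.
    - by apply: contra pX => mpN; apply/imsetP; exists (m p); rewrite ?(matchingK mm).
    - by apply: contra pN => /imsetP[u uN] /(matching_inj mm)-> //; apply: NV uN.
  (* [q] has a neighbour in [S], and it is not in [Z] because neighbours of [Z] lie in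
     [nb h V z1]. *)
  have adjR q : q \in R -> exists2 u, u \in nb h V z1 & h q (m u).
    case/RP=> qV qZ qN qX; apply/exists_inP; apply: contraT.
    rewrite negb_exists_in => /forall_inP nadj.
    have /negP[] : q \notin S by rewrite in_setU negb_or qZ.
    apply: maxS => s /setUP[sZ|/imsetP[u uN ->]]; last exact: nadj.
    apply: contra qN => hqs; apply: (subsetP (sN s sZ)).
    by rewrite in_nb qV hsym.
  have [[u1 u1N h1] [u2 u2N h2]] := (adjR p pR, adjR _ mpR).
  have u12 : u1 != u2.
    apply: contraTneq h2 => <-; rewrite hsym.
    apply: (triangle_freeN tfV pV) => //; rewrite ?(mV _ _ u1N) ?(matching_in mm) //.
    exact: (matching_adj mm).
  have z12 : z1 != z2 by rewrite eq_sym.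
  have nin : p \notin [:: u1; m u1; u2; m u2].
    rewrite !inE !negb_or; apply/and4P; split.
    - by apply: contraNneq pN => ->.
    - by apply: contraNneq pX => ->; apply: imset_f.
    - by apply: contraNneq pN => ->.
    - by apply: contraNneq pX => ->; apply: imset_f.
  have := augment7 hsym hirr maxm z1Z z2Z z12 u1N _ u12 pV mp nin.
  by rewrite N12 => /(_ u2N); rewrite hsym h1 h2.
rewrite negb_exists_in => /forall_inP nX.
pose Q z (uv : T * T) := [&& uv.1 \in nb h V z, uv.2 \in nb h V z &
  h (m uv.1) (m uv.2)].
(* An end of some edge inside [X z]; the default [z] is never reached for [z] in [Z]. *)
pose xi z := if [pick uv | Q z uv] is Some uv then m uv.1 else z.
have xiP z : z \in Z -> exists u w, [/\ u \in nb h V z, w \in nb h V z,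
    h (m u) (m w) & xi z = m u].
  move=> zZ; rewrite /xi; case: pickP => [[u w] /and3P[]|noQ]; first by exists u, w.
  case/negP: (nX z zZ); apply/indepP=> x y /imsetP[u uN ->] /imsetP[v vN ->].
  by apply/negP=> huv; have := noQ (u, v); rewrite /Q /= uN vN huv.
have disjN z z' u w : z \in Z -> z' \in Z -> z != z' -> u \in nb h V z ->
    w \in nb h V z -> h (m u) (m w) -> u \notin nb h V z'.
  move=> zZ z'Z zz' uN wN huw; apply/negP=> uN'.
  by have := augment5 hsym hirr maxm zZ z'Z zz' wN uN'; rewrite hsym huw.
(* [Z :|: xi @: Z] is independent and has [2 * #|Z|] vertices. *)
have Z3 : #|Z| <= 3.
  have xi_inj : {in Z &, injective xi}.
    move=> z z' zZ z'Z E; apply: contraTeq isT => zz'.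
    have [u [w [uN wN huw Eu]]] := xiP z zZ; have [v [_ [vN _ _ Ev]]] := xiP z' z'Z.
    have := disjN _ _ _ _ zZ z'Z zz' uN wN huw.
    have -> : u = v; last by rewrite vN.
    by apply: (matching_inj mm); rewrite ?(NV _ _ uN) ?(NV _ _ vN) // -Eu E.
  have : #|Z :|: xi @: Z| <= 7.
    apply: alpha7; apply: indepU => //.
      apply/indepP=> _ _ /imsetP[z zZ ->] /imsetP[z' z'Z ->].
      have [->|zz'] := eqVneq z z'; first by rewrite hirr.
      have [u [w [uN wN huw ->]]] := xiP z zZ; have [v [_ [vN _ _ ->]]] := xiP z' z'Z.
      exact: (augment5 hsym hirr maxm zZ z'Z).
    move=> z _ zZ /imsetP[z' z'Z ->]; have [u [w [uN wN huw ->]]] := xiP z' z'Z.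
    by rewrite hsym; apply: (Zx z').
  rewrite cardsU card_in_imset // (_ : Z :&: _ = set0) ?cards0; first by clear; lia.
  apply/eqP; rewrite setI_eq0; apply/pred0P=> x /=; apply/andP=> -[xZ].
  case/imsetP=> z' z'Z E; have [u [w [uN _ _ Eu]]] := xiP z' z'Z.
  by have := ZX _ _ z'Z uN; rewrite -Eu -E xZ.
have [z1 [z2 [z1Z z2Z z12]]] := card_gt1P Z1.
have [u1 [w1 [u1N w1N h1 _]]] := xiP z1 z1Z.
have [u2 [w2 [u2N w2N h2 _]]] := xiP z2 z2Z.
(* The two matching edges of the 5-cycle [z], [u], [m u], [m w], [w]. *)
pose K (u w : T) : {set T} := pr m u :|: pr m w.
have KP z u w a : z \in Z -> u \in nb h V z -> w \in nb h V z -> h (m u) (m w) ->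
    a \in K u w -> [/\ a \in V, m a \in K u w, m a != a, a \notin Z &
      exists v v', [/\ v \in nb h V z, v' \in nb h V z, h (m v) (m v') &
        a = v \/ a = m v]].
  move=> zZ uN wN huw aK; have [uV wV] := (NV _ _ uN, NV _ _ wN).
  have [v [v' [vN v'N hv Ea]]] : exists v v', [/\ v \in nb h V z, v' \in nb h V z, h (m v) (m v') &
        a = v \/ a = m v].
    move: aK; rewrite !inE => /orP[] /orP[] /eqP E; [exists u, w|exists u, w|
      exists w, u|exists w, u]; split=> //; first [by left|by right|by rewrite hsym].
  have aV : a \in V by case: Ea => ->; rewrite ?(NV _ _ vN) ?(mV _ _ vN).
  have ma : m a != a.
    case: Ea => ->; rewrite ?(matchingK mm) ?(NV _ _ vN) ?(nfix z) //.
    by rewrite eq_sym (nfix z).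
  split=> //; last by exists v, v'.
    move: aK; rewrite !inE => /orP[] /orP[] /eqP->;
      by rewrite ?(matchingK mm) ?eqxx ?orbT.
  by apply: contra ma => /ZP[_ ->].
have blK z u w : z \in Z -> u \in nb h V z -> w \in nb h V z -> h (m u) (m w) ->
    blocks h V m (K u w) z.
  move=> zZ uN wN huw; split.
  - by apply/subsetP=> a /(KP z u w a zZ uN wN huw)[].
  - by move=> a /(KP z u w a zZ uN wN huw)[].
  move=> I /indepP iI zI tr.
  have force v : v \in nb h V z -> v \in K u w -> m v \in I.
    move=> vN vK; case: (tr v vK) => // vI.
    by have := iI z v zI vI; rewrite (Nh _ _ vN).
  have uK : u \in K u w by rewrite !inE eqxx.
  have wK : w \in K u w by rewrite !inE eqxx !orbT.
  by have := iI _ _ (force u uN uK) (force w wN wK); rewrite huw.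
have le4 u w : #|K u w| <= 4.
  apply: leq_trans (leq_card_setU _ _) _.
  by rewrite /pr !cards2; case: (_ != _); case: (_ != _).
have bl1 := blK _ _ _ z1Z u1N w1N h1; have bl2 := blK _ _ _ z2Z u2N w2N h2.
have KP1 a := KP _ _ _ a z1Z u1N w1N h1; have KP2 a := KP _ _ _ a z2Z u2N w2N h2.
set K1 := K u1 w1 in bl1 KP1; set K2 := K u2 w2 in bl2 KP2.
have [le1 le2] : #|K1| <= 4 /\ #|K2| <= 4 by split; apply: le4.
clearbody K1 K2; clear K KP blK le4.
have dK : K1 :&: K2 = set0.
  apply/eqP; rewrite setI_eq0; apply/pred0P=> a /=; apply/andP=> -[].
  case/KP1=> _ _ _ _ [v1 [v1' [v1N v1N' hv1 E1]]].
  case/KP2=> _ _ _ _ [v2 [v2' [v2N v2N' hv2 E2]]].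
  have [v1V v2V] := (NV _ _ v1N, NV _ _ v2N).
  have nN := disjN _ _ _ _ z1Z z2Z z12 v1N v1N' hv1.
  have [E|E] : v1 = v2 \/ v1 = m v2.
    by case: E1 E2 => -> [] E; [left|right|right; rewrite -E (matchingK mm)|
      left; apply: (matching_inj mm)].
    by rewrite E v2N in nN.
  by have := Zx _ _ _ z2Z z1Z v2N; rewrite -E hsym (Nh _ _ v1N).
have c1 : 2 * #|pr m @: K1| = #|K1|.
  by apply: (card_pr mm); [case: bl1|case: bl1|move=> a /KP1[]].
have c2 : 2 * #|pr m @: K2| = #|K2|.
  by apply: (card_pr mm); [case: bl2|case: bl2|move=> a /KP2[]].
pose B' := V :\: (Z :|: (K1 :|: K2)); pose B := B' :|: (Z :\: [set z1; z2]).
have sZV : Z \subset V by apply/subsetP=> z /ZP[].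
have cB' : 2 * #|pr m @: B'| + (#|Z| + (#|K1| + #|K2|)) = #|V|.
  have sKV : Z :|: (K1 :|: K2) \subset V.
    by rewrite subUset sZV subUset; case: bl1 => -> _ _; case: bl2 => -> _ _.
  rewrite (card_pr mm) ?subsetDl //.
  - rewrite -[RHS](cardsID (Z :|: (K1 :|: K2))) (setIidPr sKV) -/B' addnC.
    congr (_ + _); rewrite cardsU (_ : Z :&: _ = set0).
      by rewrite cards0 cardsU dK cards0 !subn0.
    apply/setP=> a; rewrite in_set0; apply/negP=> /setIP[aZ /setUP[/KP1|/KP2]];
      by case=> _ _ _; rewrite aZ.
  - move=> a; rewrite !in_setD !in_setU !negb_or => /andP[/and3P[aZ aK1 aK2] aV].
    rewrite (matching_in mm) // andbT; apply/and3P; split.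
    + by apply: contra aZ => maZ; have [_ E] := ZP _ maZ;
        rewrite -(matchingK mm aV) E.
    + by apply: contra aK1 => /KP1[_ + _ _ _]; rewrite (matchingK mm).
    + by apply: contra aK2 => /KP2[_ + _ _ _]; rewrite (matchingK mm).
  - move=> a; rewrite in_setD in_setU negb_or => /andP[/andP[aZ _] aV].
    by apply: contra aZ => /eqP E; apply/unmatchedP.
have cB : #|pr m @: B| + 2 <= #|pr m @: B'| + #|Z|.
  have <- : #|Z :\: [set z1; z2]| + 2 = #|Z|.
    rewrite -(cardsID [set z1; z2] Z) addnC (setIidPr _) ?cards2 ?z12 //.
    by rewrite subUset !sub1set z1Z.
  rewrite addnA leq_add2r imsetU; apply: leq_trans (leq_card_setU _ _) _.
  by rewrite leq_add2l leq_imset_card.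
have sBV : B \subset V.
  by rewrite subUset subsetDl (subset_trans (subsetDl _ _)).
have z1K : z1 \notin K1 by apply/negP=> /KP1[_ _ _]; rewrite z1Z.
have z2K : z2 \notin K2 by apply/negP=> /KP2[_ _ _]; rewrite z2Z.
have bnd I : I \subset V :\: B -> indep h I ->
    #|I| <= #|pr m @: K1| + #|pr m @: K2|.
  move=> sI iI; have := blocks_card mm bl1 iI z1K; have := blocks_card mm bl2 iI z2K.
  have : I \subset (I :&: (z1 |: K1)) :|: (I :&: (z2 |: K2)).
    apply/subsetP=> a aI; have := subsetP sI a aI.
    rewrite !(in_setD, in_setU, in_setI) aI => /andP[nB aV].
    move: nB; rewrite aV !in_set1.
    by case: (a == z1); case: (a == z2); case: (a \in Z); case: (a \in K1); case: (a \in K2).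
  move/subset_leq_card; have := leq_of_leqif (leq_card_setU (I :&: (z1 |: K1)) (I :&: (z2 |: K2))).
  by clear; lia.
(* With four vertices in each of [K1] and [K2], the cover of [B] has at most 5 classes for [t = 3]
   and 6 for [t = 4]; the 2 beyond [t] and the 4 vertices outside [B] total only 6. *)
have := cover_bound arrV (pr_cover mm sBV) bnd.
by clear -le1 le2 cases cB cB' c1 c2 Z3 Z1 cZ; lia.
Qed.

(** By parity exactly one vertex [z] is unmatched, and [k <= 4] edges block it. The other [9 - k]
    edges less 3, plus at most [k] vertices from [z |: K], give only 6. *)
Lemma no_arr3_19 V : triangle_free h V -> #|V| = 19 -> ~ arr h V 3.
Proof.
move=> tfV cV arrV; have [m maxm] := max_matching_exists h V.
have mm := proj1 maxm; have cZ := cards_unmatched mm.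
have le1 := max_matching_unmatched tfV arrV (or_introl (conj erefl cV)) maxm.
have /eqP/cards1P[z EZ] : #|unmatched V m| = 1 by clear -cZ le1 cV; lia.
have /unmatchedP[zV mz] : z \in unmatched V m by rewrite EZ set11.
have prz : pr m z = [set z] by rewrite /pr mz setUid.
have cV' : #|V :\: pr m z| = 18.
  by have := cardsD1 z V; rewrite zV cV prz add1n => -[<-].
have nf : {in V :\: pr m z, forall x, m x != x}.
  move=> x; rewrite prz in_setD1 => /andP[xz xV]; apply: contra xz => /eqP mx.
  by rewrite -in_set1 -EZ; apply/unmatchedP.
have deg : 4 <= #|nb h V z :\ m z|.
  have := arr_min_degree hsym hirr alpha7 (ltn0Sn _) arrV zV.
  by rewrite mz (cardsD1 z) in_nb hirr andbF.
have [K [blK sK cK]] := blossom hsym hirr alpha7 mm tfV zV nf deg (or_introl cV').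
have zK : z \notin K by apply/negP=> /(subsetP sK); rewrite !inE eqxx.
pose B := V :\: (z |: K); have [sKV clK _] := blK.
have cpK : 2 * #|pr m @: K| = #|K|.
  by apply: (card_pr mm) => // x /(subsetP sK)/nf.
have cpB : 2 * #|pr m @: B| + #|K|.+1 = 19.
  rewrite (card_pr mm) ?subsetDl //.
  - rewrite -cV -(cardsID (z |: K) V) (setIidPr _) ?cardsU1 ?zK ?add1n 1?addnC //.
    by rewrite subUset sub1set zV.
  - move=> x; rewrite !in_setD !in_setU1 !negb_or => /andP[/andP[xz xK] xV].
    rewrite (matching_in mm) // andbT; apply/andP; split.
      by apply: contra xz => /eqP E; rewrite -(matchingK mm xV) E mz.
    by apply: contra xK => /clK; rewrite (matchingK mm).
  - move=> x; rewrite in_setD in_setU1 negb_or => /andP[/andP[xz _] xV].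
    by apply: nf; rewrite prz in_setD1 xz.
have bnd I : I \subset V :\: B -> indep h I -> #|I| <= #|pr m @: K|.
  move=> sI iI; have := blocks_card mm blK iI zK; rewrite (setIidPl _) //.
  apply: subset_trans sI _; rewrite setDDr setDv set0U; exact: subsetIr.
have := cover_bound arrV (pr_cover mm (subsetDl _ _ : B \subset V)) bnd.
by clear -cpB cpK cK cV'; lia.
Qed.

(** The matching is perfect. Blocking both ends of one edge gives [k <= 7] edges without independent
    transversal, hence at most [k - 1] independent vertices there; with the other [11 - k] edges
    less 4 this gives only 6. *)
Lemma no_arr4_22 V : triangle_free h V -> #|V| = 22 -> ~ arr h V 4.
Proof.
move=> tfV cV arrV; have [m maxm] := max_matching_exists h V.
have mm := proj1 maxm; have cZ := cards_unmatched mm.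
have le1 := max_matching_unmatched tfV arrV (or_intror (conj erefl cV)) maxm.
have /eqP : #|unmatched V m| = 0 by clear -cZ le1 cV; lia.
rewrite cards_eq0 => /eqP EZ.
have nf x : x \in V -> m x != x.
  by move=> xV; apply/negP=> /eqP mx; have := in_set0 x; rewrite -EZ inE xV mx eqxx.
have /card_gt0P[y yV] : 0 < #|V| by rewrite cV.
have myV := matching_in mm yV; have mmy := matchingK mm yV.
have cV' x : x \in V -> #|V :\: pr m x| = 20.
  move=> xV; have := cardsID (pr m x) V; rewrite (setIidPr _).
    by rewrite cards2 eq_sym nf // cV => -[].
  by rewrite subUset !sub1set xV (matching_in mm).
have deg x : x \in V -> 4 <= #|nb h V x :\ m x|.
  move=> xV; have := arr_min_degree hsym hirr alpha7 (ltn0Sn _) arrV xV.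
  by rewrite (cardsD1 (m x)); case: (_ \in _) => [|/ltnW].
have block x : x \in V -> exists K, [/\ blocks h V m K x, K \subset V :\: pr m x & #|K| <= 6].
  move=> xV; have nf' : {in V :\: pr m x, forall z, m z != z}.
    by move=> z /setDP[zV _]; apply: nf.
  have [K [blK sK cK]] :=
    blossom hsym hirr alpha7 mm tfV xV nf' (deg x xV) (or_intror (cV' x xV)).
  by exists K; split=> //; case: cK => [//|[_]]; rewrite cV'.
have [K1 [bl1 _ c1]] := block y yV; have [K2 [bl2 _ c2]] := block _ myV.
pose K := pr m y :|: (K1 :|: K2).
have [sK1 cl1 bK1] := bl1; have [sK2 cl2 bK2] := bl2.
have sKV : K \subset V by rewrite !subUset !sub1set yV myV sK1.
have clK : closed_under m K.
  move=> x; rewrite !inE => /or3P[/orP[]/eqP->|/cl1->|/cl2->];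
    by rewrite ?mmy ?eqxx ?orbT.
have clB : closed_under m (V :\: K).
  move=> x; rewrite !in_setD => /andP[xK xV]; rewrite (matching_in mm) // andbT.
  by apply: contra xK => /clK; rewrite (matchingK mm).
have cpK : 2 * #|pr m @: K| = #|K| by apply: (card_pr mm) => // x /(subsetP sKV)/nf.
have cpB : 2 * #|pr m @: (V :\: K)| + #|K| = 22.
  rewrite (card_pr mm) ?subsetDl // => [|x /setDP[xV _]]; last exact: nf.
  by rewrite -cV -(cardsID K V) (setIidPr sKV) addnC.
have cK : #|K| <= 14.
  apply: leq_trans (leq_card_setU _ _) _; rewrite cards2.
  have := leq_of_leqif (leq_card_setU K1 K2); clear -c1 c2; case: (_ != _); lia.
have yK : y \in K by rewrite !inE eqxx.
have bnd I : I \subset V :\: (V :\: K) -> indep h I -> #|I| <= #|pr m @: K|.-1.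
  rewrite setDDr setDv set0U (setIidPr sKV) => sIK iI.
  have := indep_card_pr mm sKV sIK iI; rewrite leq_eqVlt => /orP[/eqP E|].
    have tr := pr_transversal mm sKV sIK iI.
    rewrite E in tr; have {}tr := tr (leqnn _).
    case: (tr y yK) => yI.
      case: (bK1 I iI yI) => x xK; apply: tr.
      by rewrite !in_setU xK orbT.
    case: (bK2 I iI yI) => x xK; apply: tr.
    by rewrite !in_setU xK !orbT.
  by clear; lia.
have := cover_bound arrV (pr_cover mm (subsetDl V K)) bnd.
have K0 : 0 < #|K| by apply/card_gt0P; exists y.
by clear -cpK cpB cK K0; lia.
Qed.

End SmallTriangleFree.

(** * The lower bound *)

Section LowerBound.
Context {T : finType} (h : rel T).
Hypotheses (hsym : symmetric h) (hirr : irreflexive h).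
Hypothesis alpha7 : forall I : {set T}, indep h I -> #|I| <= 7.
Implicit Types (V A B C D I J K O P Q S : {set T}) (x y z v w : T).

Definition arr_ge t b := forall V, arr h V t -> b <= #|V|.

Definition triangle V C := [&& C \subset V, #|C| == 3 &
  [forall x in C, forall y in C, (x != y) ==> h x y]].

Lemma triangleP V C : reflect [/\ C \subset V, #|C| = 3 &
  {in C &, forall x y, x != y -> h x y}] (triangle V C).
Proof.
apply: (iffP and3P) => -[sC /eqP cC hC]; split=> //.
  by move=> x y xC yC; apply/implyP; apply: (forall_inP (forall_inP hC x xC)).
by apply/forall_inP=> x xC; apply/forall_inP=> y yC; apply/implyP; apply: hC.
Qed.

Lemma triangle3 V x y z : x \in V -> y \in V -> z \in V -> h x y -> h x z -> h y z ->
  triangle V [set x; y; z].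
Proof.
move=> xV yV zV xy xz yz; have neq a b : h a b -> a != b.
  by apply: contraTneq => ->; rewrite hirr.
apply/triangleP; split.
- by rewrite !subUset !sub1set xV yV zV.
- by rewrite setUC cardsU1 cards2 in_set2 negb_or !(eq_sym z) !neq.
- move=> a b; rewrite !inE => /orP[/orP[]|] /eqP-> /orP[/orP[]|] /eqP-> //;
    by rewrite ?eqxx // hsym.
Qed.

Lemma triangle_freeVtriangle V : triangle_free h V \/ exists C, triangle V C.
Proof.
have [/forall_inP tf|] := boolP [forall x in V, indep h (nb h V x)]; first by left.
rewrite negb_forall_in => /exists_inP[x xV nI]; right.
move: nI; rewrite negb_forall_in => /exists_inP[y yN].
rewrite negb_forall_in => /exists_inP[z zN /negPn yz].
move: yN zN; rewrite !in_nb => /andP[yV xy] /andP[zV xz].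
by exists [set x; y; z]; apply: triangle3.
Qed.

Lemma triangle_remove V C t : triangle V C -> arr h V t.+1 ->
  arr h (V :\: C) t /\ #|V :\: C| + 3 = #|V|.
Proof.
case/triangleP=> sC cC hC arrV; split; first exact: arr_remove arrV.
by rewrite -(cardsID C V) (setIidPr sC) cC addnC.
Qed.

(** An independent 7-set has at least [7 + t] neighbours. *)
Lemma arr_card V t : 0 < t -> arr h V t -> t + 14 <= #|V|.
Proof.
move=> t0 arrV; have [J [sJ iJ cJ]] := arr_indep arrV.
have := expansion hsym alpha7 t0 arrV sJ _ iJ; rewrite -card_gt0 cJ => /(_ isT) le.
apply: leq_trans (_ : #|J :|: nbs h V J| <= _).
  rewrite cardsU cJ (_ : J :&: _ = set0) ?cards0; first by clear -le; lia.
  apply/eqP; rewrite setI_eq0; apply/pred0P=> y /=; apply/andP=> -[yJ].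
  by case/nbsP=> x xJ /andP[+ _]; apply/negP; move/indepP: iJ; apply.
by apply: subset_leq_card; rewrite subUset sJ; apply/subsetP=> y /nbsP[x _ /andP[]].
Qed.

Lemma arr_edge V t : arr h V t.+1 -> exists x y, [/\ x \in V, y \in V & h x y].
Proof.
move=> arrV; have [J [sJ _ cJ]] := arr_indep arrV.
have /card_gt0P[x xJ] : 0 < #|J| by rewrite cJ.
have xV := subsetP sJ x xJ; have deg := arr_min_degree hsym hirr alpha7 (ltn0Sn t) arrV xV.
have /card_gt0P[y] : 0 < #|nb h V x| by apply: leq_trans deg.
rewrite in_nb => /andP[yV xy].
by exists x, y.
Qed.

Lemma arr_ge_edge t b : arr_ge t b -> arr_ge t.+1 (b + 2).
Proof.
move=> ge V arrV; have [x [y [xV yV xy]]] := arr_edge arrV.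
have nxy : x != y by apply: contraTneq xy => ->; rewrite hirr.
have : b <= #|V :\: [set x; y]|.
  apply: ge; apply: arr_remove arrV => a c; rewrite !inE.
  by move=> /orP[] /eqP-> /orP[] /eqP->; rewrite ?eqxx // hsym.
rewrite -(cardsID [set x; y] V) (setIidPr _); last by rewrite subUset !sub1set xV.
by rewrite cards2 nxy; clear; lia.
Qed.

Lemma arr_ge_triangle t b V C : arr_ge t b -> arr h V t.+1 -> triangle V C ->
  b + 3 <= #|V|.
Proof.
by move=> ge arrV /triangle_remove/(_ arrV)[/ge + <-]; rewrite leq_add2r.
Qed.

Lemma arr_ge1 : arr_ge 1 15. Proof. by move=> V /(arr_card (ltn0Sn _)). Qed.

Lemma arr_ge2 : arr_ge 2 17. Proof. exact: arr_ge_edge arr_ge1. Qed.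

Lemma arr_ge3 : arr_ge 3 20.
Proof.
move=> V arrV; have [tfV|[C triC]] := triangle_freeVtriangle V.
  have := arr_ge_edge arr_ge2 arrV; rewrite leq_eqVlt => /orP[/eqP E|//].
  by case: (no_arr3_19 hsym hirr alpha7 tfV (esym E) arrV).
exact: arr_ge_triangle arr_ge2 arrV triC.
Qed.

Lemma arr_ge4 : arr_ge 4 23.
Proof.
move=> V arrV; have [tfV|[C triC]] := triangle_freeVtriangle V.
  have := arr_ge_edge arr_ge3 arrV; rewrite leq_eqVlt => /orP[/eqP E|//].
  by case: (no_arr4_22 hsym hirr alpha7 tfV (esym E) arrV).
exact: arr_ge_triangle arr_ge3 arrV triC.
Qed.

(** * Double counting and triangles for [t = 6] *)

Lemma card_nb B w : #|nb h B w| = \sum_(v in B) (h w v : nat).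
Proof.
rewrite -sum1_card [LHS]big_mkcond [RHS]big_mkcond; apply: eq_bigr => v _.
by rewrite in_nb; case: (v \in B); case: (h w v).
Qed.

Lemma sum_nb A B : \sum_(w in A) #|nb h B w| = \sum_(v in B) #|nb h A v|.
Proof.
rewrite (eq_bigr _ (fun w _ => card_nb B w)) exchange_big /=.
rewrite [RHS](eq_bigr _ (fun v _ => card_nb A v)).
by apply: eq_bigr => v _; apply: eq_bigr => w _; rewrite hsym.
Qed.

(** Both sides count the walks [v1], [w], [v2] with middle vertex in [A] and ends in [B]. *)
Lemma sum_nb_sqr A B : \sum_(w in A) #|nb h B w| ^ 2 =
  \sum_(v1 in B) \sum_(v2 in B) #|nb h A v1 :&: nb h A v2|.
Proof.
under eq_bigr => w _ do rewrite card_nb -mulnn big_distrlr /=.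
rewrite exchange_big /=; apply: eq_bigr => v1 _.
rewrite exchange_big /=; apply: eq_bigr => v2 _.
rewrite -sum1_card [LHS]big_mkcond [RHS]big_mkcond; apply: eq_bigr => w _.
rewrite !inE (hsym w) (hsym w); case: (w \in A) => //=.
by case: (h v1 w); case: (h v2 w).
Qed.

(* [N(v1) :|: N(v2)] is covered by 7 cliques by König's theorem, and [c1], [c2]
   are singletons of this cover to which [v1] and [v2] can be added; no vertex of
   an independent set outside is adjacent to [v1] or [v2]. *)
Lemma no_common_pair V Q v1 v2 c1 c2 : arr h V 6 ->
    v1 \in V :\: Q -> v2 \in V :\: Q -> v1 != v2 -> ~~ h v1 v2 ->
    indep h (nb h V v1 :\: Q) -> indep h (nb h V v2 :\: Q) -> c1 != c2 ->
    c1 \in (nb h V v1 :\: Q) :&: (nb h V v2 :\: Q) ->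
    c2 \in (nb h V v1 :\: Q) :&: (nb h V v2 :\: Q) ->
  ~ {in v1 |: (c1 |: Q) &, forall x y, x != y -> h x y}.
Proof.
move=> arrV v1V v2V v12 n12; set A1 := _ :\: _; set A2 := _ :\: _ => i1 i2 c12.
move=> /setIP[c11 c1A2] /setIP[c2A1 c22] clQ; set W := A1 :|: A2.
have [f [covf cf cIso]] := konig_cover hsym hirr alpha7 i1 i2.
have isoW c : c \in A1 -> c \in A2 -> {in W, forall x, ~~ h c x}.
  move=> cA1 cA2 x /setUP[] xA; [move/indepP: i1|move/indepP: i2]; exact.
have [c1W c2W] : c1 \in W /\ c2 \in W by rewrite !in_setU c11 c2A1.
have [fc1 fc1'] := cIso _ c1W (isoW _ c11 c1A2).
have [fc2 fc2'] := cIso _ c2W (isoW _ c2A1 c22).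
have nW i : i \in [set v1; v2] :|: Q -> i \notin W.
  rewrite !inE => /orP[/orP[]/eqP->|->//];
    by rewrite hirr ?(negbTE n12) ?[h v2 _]hsym ?(negbTE n12) !andbF.
(* [v2] joins the class of [c2]; [v1] and the clique [Q] join that of [c1]. *)
pose g x := if x \in W then f x else if x == v2 then c2 else c1.
pose B := W :|: ([set v1; v2] :|: Q).
have adj i v : i \in A1 :&: A2 -> v \in [set v1; v2] -> h i v.
  move=> /setIP[/setDP[+ _] /setDP[+ _]]; rewrite !in_nb => /andP[_ h1] /andP[_ h2].
  by rewrite !inE => /orP[] /eqP->; rewrite hsym.
have covg : clique_cover h g B.
  have side x y : x \in W -> y \in B -> y \notin W -> f x = g y -> h x y.
    move=> xW yB yW; rewrite /g (negbTE yW).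
    have := yB; rewrite in_setU (negbTE yW) /= => yQ.
    case: eqVneq => [-> /(fc2' x xW)->|y2 /(fc1' x xW)->].
      by apply: adj; rewrite ?in_setI ?c2A1 // in_set2 eqxx orbT.
    have yc : y \in v1 |: (c1 |: Q).
      by move: yQ; rewrite !inE (negbTE y2) orbF => /orP[->//|->]; rewrite !orbT.
    apply: clQ => //; first by rewrite !inE eqxx orbT.
    by apply: contraNneq yW => <-.
  move=> x y xB yB; have [xW|xW] := boolP (x \in W).
    have [yW|yW] := boolP (y \in W); first by rewrite /g xW yW; apply: covf.
    by rewrite {1}/g xW => /side-> //.
  have [yW|yW] := boolP (y \in W).
    by rewrite {2}/g yW => E _; rewrite hsym side // E.
  have inQ z : z \in B -> z \notin W -> z != v2 -> z \in v1 |: (c1 |: Q).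
    move=> zB zW z2.
    have zQ : z \in [set v1; v2] :|: Q by case/setUP: zB => // zW'; rewrite zW' in zW.
    by move: zQ; rewrite !inE (negbTE z2) orbF => /orP[] ->; rewrite ?orbT.
  rewrite /g (negbTE xW) (negbTE yW); case: eqVneq => [->|x2]; case: eqVneq => [->|y2].
  - by [].
  - by move=> E; rewrite E eqxx in c12.
  - by move=> E; rewrite E eqxx in c12.
  - by move=> _; apply: clQ; apply: inQ.
have cg : #|g @: B| <= 7.
  apply: leq_trans cf; apply: subset_leq_card; apply/subsetP=> _ /imsetP[x _ ->].
  rewrite /g; case: ifP => xW; first exact: imset_f.
  by case: ifP => _; apply/imsetP; [exists c2|exists c1].
have bnd I : I \subset V :\: B -> indep h I -> #|I| <= 5.
  move=> sI iI; have nadj x i : i \in I -> x \in [set v1; v2] -> ~~ h x i.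
    move=> /(subsetP sI)/setDP[iV iB] xv; apply: contra iB => hxi.
    have [iQ|iQ] := boolP (i \in Q); first by rewrite /B !in_setU iQ !orbT.
    move: xv; rewrite in_set2 => /orP[] /eqP xE; rewrite xE in hxi.
      by rewrite /B /W !in_setU /A1 in_setD iQ in_nb iV hxi.
    by rewrite /B /W !in_setU /A2 [_ \in nb h V v2 :\: Q]in_setD iQ in_nb iV hxi orbT.
  have i12 : indep h [set v1; v2].
    by apply: (indepU hsym (indep1 hirr _) (indep1 hirr _)) => x y /set1P-> /set1P->.
  have := alpha7 (indepU hsym i12 iI (fun x y xv yI => nadj x y yI xv)).
  rewrite cardsU cards2 v12 (_ : _ :&: I = set0) ?cards0; first by clear; lia.
  apply/eqP; rewrite setI_eq0; apply/pred0P=> x /=; apply/andP=> -[xv].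
  by move/(subsetP sI)/setDP=> [_]; rewrite /B in_setU (in_setU x _ Q) xv orbT.
(* Seven classes less [t = 6], plus 5, give only 6. *)
have := cover_bound arrV covg bnd; clear -cg; lia.
Qed.

Definition off_triangles V := [set v in V | indep h (nb h V v)].

Lemma off_triangles_codegree V v1 v2 : arr h V 6 -> v1 \in off_triangles V ->
  v2 \in off_triangles V -> v1 != v2 -> #|nb h V v1 :&: nb h V v2| <= 1.
Proof.
move=> arrV; rewrite !inE => /andP[v1V i1] /andP[v2V i2] v12.
rewrite leqNgt; apply/negP=> /card_gt1P[c1 [c2 [c1N c2N c12]]].
have n12 : ~~ h v1 v2.
  apply/negP=> h12; move: c1N => /setIP[c11]; rewrite in_nb => /andP[_ h2].
  by move/indepP: i1 => /(_ v2 c1); rewrite in_nb v2V h12 h2 c11 => /(_ isT isT).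
apply: (@no_common_pair V set0 v1 v2 c1 c2); rewrite ?setD0 //.
move: c1N; rewrite !inE => /andP[/andP[_ h1] _].
by move=> x y; rewrite !inE !orbF => /orP[] /eqP-> /orP[] /eqP->;
   rewrite ?eqxx // hsym.
Qed.

(** Nine such vertices would have degree exactly 7 and pairwise at most one common neighbour. The
    degrees into them sum to 63 and their squares to at most 135, but [5 * 63 > 135 + 6 * 28]. *)
Lemma card_off_triangles V : arr h V 6 -> #|V| <= 28 -> #|off_triangles V| <= 8.
Proof.
move=> arrV cV; rewrite leqNgt; apply/negP=> lt8.
pose s := take 9 (enum (off_triangles V)); pose D := [set x in s].
have us : uniq s by apply: take_uniq; apply: enum_uniq.
have cD : #|D| = 9.
  by rewrite cardsE (card_uniqP us) size_take -cardE; case: ifP lt8; clear; lia.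
have DN v : v \in D -> v \in off_triangles V.
  by rewrite inE => /mem_take; rewrite mem_enum.
have deg v : v \in D -> #|nb h V v| = 7.
  move/DN; rewrite inE => /andP[vV iv]; apply/eqP; rewrite eqn_leq alpha7 //=.
  exact: (arr_min_degree hsym hirr alpha7).
have s1 : \sum_(w in V) #|nb h D w| = 63.
  by rewrite sum_nb (eq_bigr _ deg) sum_nat_const cD.
have s2 : \sum_(w in V) #|nb h D w| ^ 2 <= 135.
  rewrite sum_nb_sqr; apply: leq_trans (_ : \sum_(v in D) 15 <= _).
    apply: leq_sum => v vD; rewrite (bigD1 v vD) /= setIid (deg v vD).
    rewrite -[15]/(7 + 8) leq_add2l.
    have <- : \sum_(i in D | i != v) 1 = 8.
      by rewrite sum1dep_card -[8]/(9.-1) -cD (cardsD1 v D) vD /=;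
         apply: eq_card => i; rewrite !inE andbC.
    apply: leq_sum => i /andP[iD iv]; rewrite off_triangles_codegree ?DN //.
    by rewrite eq_sym.
  by rewrite sum_nat_const cD.
(* (d - 2)(d - 3) >= 0 for each degree d into [D] *)
have : \sum_(w in V) 5 * #|nb h D w| <= \sum_(w in V) (#|nb h D w| ^ 2 + 6).
  by apply: leq_sum => w _; rewrite -mulnn; move: #|_|; clear;
     case=> [|[|[|d]]] //; nia.
rewrite -big_distrr big_split /= sum_nat_const s1; clear -s2 cV; lia.
Qed.

(* If all triangles contained [x], every pair of neighbours other than [x] of a
   vertex of [K] would have this vertex as its only common neighbour in [K]; at
   least 19 * 30 such ordered pairs do not fit among the non-adjacent ones. *)
Lemma triangles_no_common_vertex V x : arr h V 6 -> #|V| = 28 -> x \in V ->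
  exists C, triangle V C && (x \notin C).
Proof.
move=> arrV cV xV; apply/existsP; apply: contraT; rewrite negb_exists => /forallP noC.
pose V1 := V :\ x; pose K := nb h V x.
have V1P v : v \in V1 -> v \in V /\ v != x by rewrite !inE => /andP[].
have cV1 : #|V1| = 27 by have := cardsD1 x V; rewrite xV cV add1n => -[].
have nbE v : nb h V v :\: [set x] = nb h V1 v.
  by apply/setP=> y; rewrite !inE andbA.
have i1 v : v \in V1 -> indep h (nb h V1 v).
  case/V1P=> vV vx; apply/indepP=> y z; rewrite !in_nb => /andP[/V1P[yV yx] hy].
  move=> /andP[/V1P[zV zx] hz]; apply/negP=> yz; have := noC [set v; y; z].
  by rewrite triangle3 //= !inE !negb_or eq_sym vx eq_sym yx eq_sym zx.
have sKV1 : K \subset V1.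
  by apply/subsetP=> y; rewrite !inE => /andP[-> hxy]; rewrite andbT;
     apply: contraTneq hxy => ->; rewrite hirr.
(* A vertex other than [x] and not adjacent to it is off all triangles; at most 8 of the 27 are. *)
have cK : 19 <= #|K|.
  have : #|V1 :\: K| <= 8.
    apply: leq_trans (card_off_triangles arrV _); last by rewrite cV.
    apply: subset_leq_card; apply/subsetP=> v /setDP[vV1 vK].
    have [vV vx] := V1P v vV1; rewrite inE vV; apply: indepS (i1 v vV1).
    apply/subsetP=> y; rewrite !inE => /andP[yV hvy]; rewrite yV hvy !andbT.
    by apply: contra vK => /eqP E; rewrite in_nb vV -E hsym.
  have := cardsID K V1; rewrite (setIidPr sKV1) cV1; clear; lia.
have deg v : v \in V1 -> 6 <= #|nb h V1 v|.
  case/V1P=> vV _; have := arr_min_degree hsym hirr alpha7 (ltn0Sn _) arrV vV.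
  by rewrite (cardsD1 x (nb h V v)) -nbE; case: (_ \in _) => [|/ltnW].
have codeg v1 v2 : v1 \in V1 -> v2 \in V1 -> v1 != v2 ->
    #|nb h K v1 :&: nb h K v2| <= ~~ h v1 v2.
  move=> v1V1 v2V1 v12; have [[v1V v1x] [v2V v2x]] := (V1P _ v1V1, V1P _ v2V1).
  have KN v w : w \in nb h K v -> [/\ w \in nb h V1 v, w \in nb h V v, h v w, h x w & w != x].
    rewrite !inE => /andP[/andP[wV hxw] hvw].
    have wx : w != x by apply: contraTneq hxw => ->; rewrite hirr.
    by rewrite wV hvw hxw wx.
  have [h12|n12] /= := boolP (h v1 v2).
    rewrite leqn0 cards_eq0; apply/eqP/setP=> w; rewrite in_set0; apply/negP.
    move=> /setIP[/KN[w1 _ _ _ _] /KN[_ _ h2 _ _]].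
    move/indepP: (i1 _ v1V1) => /(_ v2 w); rewrite w1 h2 in_nb v2V1 h12.
    by move=> /(_ isT isT).
  rewrite leqNgt; apply/negP=> /card_gt1P[c1 [c2 [/setIP[a1 a2] /setIP[b1 b2] c12]]].
  have [[a1' a1N h1 hx1 c1x] [a2' a2N h2 _ _]] := (KN _ _ a1, KN _ _ a2).
  have [[b1' b1N _ _ _] [b2' b2N _ _ _]] := (KN _ _ b1, KN _ _ b2).
  (* If [v1] or [v2] is adjacent to [x], it forms a clique with [x] and [c1], so [Q] is [[set x]];
     otherwise [Q] is empty. *)
  have [hx|nx1] := boolP (h x v1).
    apply: (no_common_pair (Q := [set x]) arrV v1V1 v2V1 v12 n12 _ _ c12);
      rewrite ?nbE ?in_setI ?a1' ?b1' ?i1 // => y z.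
    by rewrite !inE => /or3P[] /eqP-> /or3P[] /eqP->; rewrite ?eqxx // hsym.
  have [hx|nx2] := boolP (h x v2).
    rewrite eq_sym in v12; rewrite hsym in n12.
    apply: (no_common_pair (Q := [set x]) arrV v2V1 v1V1 v12 n12 _ _ c12);
      rewrite ?nbE ?in_setI ?a2' ?b2' ?i1 // => y z.
    by rewrite !inE => /or3P[] /eqP-> /or3P[] /eqP->; rewrite ?eqxx // hsym.
  have nbx v : ~~ h x v -> nb h V v = nb h V1 v.
    move=> nx; apply/setP=> y; rewrite !inE; case: eqVneq => //= ->.
    by rewrite [h v x]hsym (negbTE nx) andbF.
  apply: (@no_common_pair V set0 v1 v2 c1 c2); rewrite ?setD0 ?in_setI ?a1N ?b1N //.
  - by rewrite (nbx _ nx1) i1.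
  - by rewrite (nbx _ nx2) i1.
  move=> y z; rewrite !inE !orbF => /orP[] /eqP-> /orP[] /eqP->;
    by rewrite ?eqxx // hsym.
(* Each of the [27 * 26] ordered pairs of distinct vertices of [V1] contributes at most 1: an
   adjacency or a common neighbour in [K]. *)
have up : \sum_(w in K) #|nb h V1 w| ^ 2 + \sum_(v in V1) #|nb h V1 v| <=
    \sum_(w in K) #|nb h V1 w| + 27 * 26.
  rewrite sum_nb_sqr [X in _ <= X + _]sum_nb -big_split /=.
  rewrite -[X in X * _]cV1 -sum_nat_const -big_split /=; apply: leq_sum => v vV1.
  rewrite (bigD1 v vV1) /= setIid -addnA leq_add2l.
  rewrite (_ : #|nb h V1 v| = \sum_(u in V1 | u != v) (h v u : nat)); last first.
    rewrite -sum1_card big_mkcond [RHS]big_mkcond; apply: eq_bigr => u _.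
    rewrite in_nb; case: (u \in V1) => //=; case: eqVneq => [->|_].
      by rewrite hirr.
    by case: (h v u).
  rewrite -big_split /=.
  have <- : \sum_(u in V1 | u != v) 1 = 26.
    by rewrite sum1dep_card -[26]/(27.-1) -cV1 (cardsD1 v V1) vV1 /=;
       apply: eq_card => u; rewrite !inE andbC.
  apply: leq_sum => u /andP[uV1 uv]; have := codeg v u vV1 uV1.
  by rewrite eq_sym uv => /(_ isT); case: (h v u); rewrite /= ?addn0 ?leqn0 // => /eqP->.
have low : \sum_(w in K) (#|nb h V1 w| + 30) <= \sum_(w in K) #|nb h V1 w| ^ 2.
  apply: leq_sum => w wK; have := deg w (subsetP sKV1 w wK).
  by rewrite -mulnn; move: #|_| => d; clear; nia.
have low' : 27 * 6 <= \sum_(v in V1) #|nb h V1 v|.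
  by rewrite -cV1 -sum_nat_const; apply: leq_sum.
(* [19 * 30 + 27 * 6 = 732] exceeds [27 * 26 = 702]. *)
move: low; rewrite big_split /= sum_nat_const; clear -up low' cK; nia.
Qed.

(* [S] is a union of four triangles without a common vertex. A triangle with a
   vertex [v] outside [S] has its other two vertices in [S], and the edges of [S]
   obtained in this way for distinct [v] meet; unless they share a vertex, all of
   them lie in a triangle [p], [q], [r]. *)
Lemma disjoint_triangles V : arr h V 6 -> #|V| = 28 ->
  exists C C', [&& triangle V C, triangle V C' & [disjoint C & C']].
Proof.
move=> arrV cV.
have [/existsP[C /existsP[C' CC']]|] := boolP [exists C : {set T}, exists C' : {set T},
    [&& triangle V C, triangle V C' & [disjoint C & C']]]; first by exists C, C'.
rewrite negb_exists => /forallP noC; have meet C C' : triangle V C -> triangle V C' ->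
    exists y, y \in C /\ y \in C'.
  move=> tC tC'; have := noC C; rewrite negb_exists => /forallP/(_ C').
  by rewrite tC tC' /= => /pred0Pn[y /andP[]]; exists y.
have avoid := triangles_no_common_vertex arrV cV.
(* Take a triangle [T0] and, for each of its vertices, a triangle avoiding it; each of these meets
   [T0] and adds at most 2 vertices. *)
have [S [sSV cS avS]] : exists S, [/\ S \subset V, #|S| <= 9 &
    forall p, p \in V -> exists C, [/\ triangle V C, C \subset S & p \notin C]].
  have /card_gt0P[x0 x0V] : 0 < #|V| by rewrite cV.
  have [T0 /andP[tT0 _]] := avoid x0 x0V; have [sT0 cT0 _] := triangleP _ _ tT0.
  have [x [y [z xyz]]] : exists x y z, T0 = [set x; y; z].
    have /card_gt0P[x xT] : 0 < #|T0| by rewrite cT0.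
    have /cards2P[y [z [_ yz]]] : #|T0 :\ x| == 2.
      by have := cardsD1 x T0; rewrite xT cT0 add1n => -[<-].
    by exists x, y, z; rewrite -setUA -yz setD1K.
  have xT : x \in T0 by rewrite xyz !inE eqxx.
  have yT : y \in T0 by rewrite xyz !inE eqxx orbT.
  have zT : z \in T0 by rewrite xyz !inE eqxx orbT.
  have [C1 /andP[t1 n1]] := avoid x (subsetP sT0 _ xT).
  have [C2 /andP[t2 n2]] := avoid y (subsetP sT0 _ yT).
  have [C3 /andP[t3 n3]] := avoid z (subsetP sT0 _ zT).
  have add C S : triangle V C -> T0 \subset S -> #|C :|: S| <= #|S| + 2.
    move=> tC sS; have [u [uC uT]] := meet _ _ tC tT0; have [_ cC _] := triangleP _ _ tC.
    have : 0 < #|C :&: S| by apply/card_gt0P; exists u; rewrite inE uC (subsetP sS).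
    by rewrite cardsU cC; clear; lia.
  exists (C1 :|: (C2 :|: (C3 :|: T0))); split.
  - by rewrite !subUset sT0; case/triangleP: t1 => -> _ _; case/triangleP: t2 => -> _ _;
       case/triangleP: t3 => -> _ _.
  - have le3 := add C3 T0 t3 (subxx _).
    have le2 := add C2 _ t2 (subsetUr C3 T0).
    have le1 := add C1 _ t1 (subset_trans (subsetUr C3 T0) (subsetUr C2 _)).
    by move: le1 le2 le3; rewrite cT0; clear; lia.
  move=> p _; have [|pT] := boolP (p \in T0).
    rewrite xyz !inE => /orP[/orP[]|] /eqP->; [exists C1|exists C2|exists C3];
    by split=> //; apply/subsetP=> u uC; rewrite !inE uC ?orbT.
  by exists T0; split=> //; apply/subsetP=> u uC; rewrite !inE uC ?orbT.
(* Otherwise [p], [v], [v'] form a triangle disjoint from one inside [S] that avoids [p]. *)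
have noedge p v v' : p \in V -> v \in V -> v' \in V -> v \notin S -> v' \notin S ->
    h p v -> h p v' -> ~~ h v v'.
  move=> pV vV v'V vS v'S hv hv'; apply/negP=> hvv'; have [C [tC sC pC]] := avS p pV.
  have [y [yC]] := meet _ _ tC (triangle3 pV vV v'V hv hv' hvv').
  have yS := subsetP sC _ yC.
  by rewrite !inE => /orP[/orP[]|] /eqP E; rewrite -E ?yC ?yS // in pC vS v'S.
pose D := (V :\: S) :\: off_triangles V.
have DP v : v \in D -> [/\ v \in V, v \notin S & ~~ indep h (nb h V v)].
  by rewrite !inE => /and3P[+ -> vV]; rewrite vV.
have cD : 11 <= #|D|.
  have := card_off_triangles arrV; rewrite cV => /(_ isT) c8.
  have := cardsID S V; have := cardsID (off_triangles V) (V :\: S); rewrite -/D cV.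
  have := subset_leq_card (subsetIr V S).
  have := subset_leq_card (subsetIr (V :\: S) (off_triangles V)).
  by clear -c8 cS; lia.
have edge v : v \in D -> exists p q, [/\ p \in S, q \in S, h v p, h v q & h p q].
  case/DP=> vV vS; rewrite negb_forall_in => /exists_inP[p pN].
  rewrite negb_forall_in => /exists_inP[q qN /negPn hpq].
  move: pN qN; rewrite !in_nb => /andP[pV hvp] /andP[qV hvq].
  exists p, q; split=> //; apply: contraT => nS.
    by have := @noedge q v p qV vV pV vS nS; rewrite !(hsym q) hvq hpq hvp => /(_ isT isT).
  by have := @noedge p v q pV vV qV vS nS; rewrite (hsym p v) hvp hpq hvq => /(_ isT isT).
have cross v v' p q p' q' : v \in D -> v' \in D -> v != v' -> p \in S -> q \in S ->
    p' \in S -> q' \in S -> h v p -> h v q -> h p q -> h v' p' -> h v' q' -> h p' q' ->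
    [|| p == p', p == q', q == p' | q == q'].
  move=> /DP[vV vS _] /DP[v'V v'S _] vv' pS qS p'S q'S h1 h2 h3 h4 h5 h6.
  have [pV qV] := (subsetP sSV _ pS, subsetP sSV _ qS).
  have [p'V q'V] := (subsetP sSV _ p'S, subsetP sSV _ q'S).
  have [y []] := meet _ _ (triangle3 vV pV qV h1 h2 h3) (triangle3 v'V p'V q'V h4 h5 h6).
  rewrite !inE => /orP[/orP[]|] /eqP-> /orP[/orP[]|] E; rewrite ?E ?orbT //.
  - by rewrite E in vv'.
  - by rewrite (eqP E) p'S in vS.
  - by rewrite (eqP E) q'S in vS.
  - by rewrite -(eqP E) pS in v'S.
  - by rewrite -(eqP E) qS in v'S.
have cN p : p \in S -> #|nb h D p| <= 7.
  move=> pS; apply: alpha7; apply/indepP=> v v'; rewrite !in_nb.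
  move=> /andP[/DP[vV vS _] hv] /andP[/DP[v'V v'S _] hv'].
  exact: (@noedge p v v' (subsetP sSV _ pS)).
have far p : p \in S -> exists2 v, v \in D & ~~ h v p.
  move=> /cN le7; apply/exists_inP; apply: contraT; rewrite negb_exists_in => /forall_inP all.
  have : #|D| <= 7.
    apply: leq_trans le7; apply: subset_leq_card; apply/subsetP=> v vD.
    by rewrite in_nb vD hsym; apply: negbNE; apply: all.
  by clear -cD; lia.
have /card_gt0P[v1 v1D] : 0 < #|D| by apply: leq_trans cD.
have [p [q [pS qS h1p h1q hpq]]] := edge _ v1D.
have [v2 v2D n2p] := far p pS.
have v12 : v1 != v2 by apply: contraNneq n2p => <-.
have [r [rS h2q h2r hqr]] : exists r, [/\ r \in S, h v2 q, h v2 r & h q r].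
  have [a [b [aS bS ha hb hab]]] := edge _ v2D.
  case/or4P: (cross _ _ _ _ _ _ v1D v2D v12 pS qS aS bS h1p h1q hpq ha hb hab) => /eqP E.
  - by rewrite E ha in n2p.
  - by rewrite E hb in n2p.
  - by exists b; rewrite E.
  - by exists a; rewrite E [h b a]hsym.
have [v3 v3D n3q] := far q qS.
have v13 : v1 != v3 by apply: contraNneq n3q => <-.
have v23 : v2 != v3 by apply: contraNneq n3q => <-.
have pr : p != r by apply: contraNneq n2p => ->.
(* The edge obtained for [v3] misses [q], so it meets [pq] in [p] and [qr] in [r]. *)
have [h3p h3r hpr] : [/\ h v3 p, h v3 r & h p r].
  have [a [b [aS bS ha hb hab]]] := edge _ v3D.
  have := cross _ _ _ _ _ _ v1D v3D v13 pS qS aS bS h1p h1q hpq ha hb hab.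
  have := cross _ _ _ _ _ _ v2D v3D v23 qS rS aS bS h2q h2r hqr ha hb hab.
  have qa : q != a by apply: contraNneq n3q => ->.
  have qb : q != b by apply: contraNneq n3q => ->.
  rewrite (negbTE qa) (negbTE qb) /= !orbF => /orP[] /eqP Er /orP[] /eqP Ep.
  - by rewrite Er Ep eqxx in pr.
  - by rewrite Er Ep [h b a]hsym.
  - by rewrite Er Ep.
  - by rewrite Er Ep eqxx in pr.
have two v : v \in D -> 2 <= h p v + h q v + h r v.
  move=> vD; rewrite !(hsym _ v).
  have [<-|n1] := eqVneq v1 v; first by rewrite h1p h1q.
  have [<-|n2] := eqVneq v2 v; first by rewrite h2q h2r; case: (h _ p).
  have [<-|n3] := eqVneq v3 v; first by rewrite h3p h3r; case: (h _ q).
  have [a [b [aS bS ha hb hab]]] := edge _ vD.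
  have h1 : h v p || h v q.
    by case/or4P: (cross _ _ _ _ _ _ v1D vD n1 pS qS aS bS h1p h1q hpq ha hb hab) =>
      /eqP->; rewrite ?ha ?hb ?orbT.
  have h2 : h v q || h v r.
    by case/or4P: (cross _ _ _ _ _ _ v2D vD n2 qS rS aS bS h2q h2r hqr ha hb hab) =>
      /eqP->; rewrite ?ha ?hb ?orbT.
  have h3 : h v p || h v r.
    by case/or4P: (cross _ _ _ _ _ _ v3D vD n3 pS rS aS bS h3p h3r hpr ha hb hab) =>
      /eqP->; rewrite ?ha ?hb ?orbT.
  by move: h1 h2 h3; case: (h v p); case: (h v q); case: (h v r).
(* At least 22 adjacencies, while [p], [q], [r] have at most 7 neighbours each in [D]. *)
have : 2 * #|D| <= \sum_(v in D) (h p v + h q v + h r v).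
  by rewrite mulnC -sum_nat_const; apply: leq_sum.
rewrite !big_split /= -!card_nb; have := cN p pS; have := cN q qS; have := cN r rS.
by clear -cD; lia.
Qed.

Lemma arr_ge6 : arr_ge 6 29.
Proof.
move=> V arrV; rewrite ltnNge; apply/negP=> cV.
have ge5 : arr_ge 5 25 := arr_ge_edge arr_ge4.
have [tfV|[C triC]] := triangle_freeVtriangle V.
  have := card_off_triangles arrV cV; have := arr_card (ltn0Sn _) arrV.
  suff -> : off_triangles V = V by clear; lia.
  by apply/setP=> v; rewrite inE andb_idr // => vV; apply: tfV.
have {}cV : #|V| = 28.
  by apply/eqP; rewrite eqn_leq cV (arr_ge_triangle ge5 arrV triC).
have [C1 [C2 /and3P[t1 t2 d12]]] := disjoint_triangles arrV cV.
have [arr1 c1] := triangle_remove t1 arrV.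
have t2' : triangle (V :\: C1) C2.
  case/triangleP: t2 => s2 c2 h2; apply/triangleP; split=> //.
  by rewrite subsetD s2 disjoint_sym.
have := arr_ge_triangle arr_ge4 arr1 t2'; clear -c1 cV; lia.
Qed.

Lemma arr_ge_from6 t : arr_ge (t + 6) (3 * t + 29).
Proof.
elim: t => [|t IHt] V arrV; first exact: arr_ge6.
have [tfV|[C triC]] := triangle_freeVtriangle V; last first.
  by have := arr_ge_triangle IHt arrV triC; rewrite mulnS; clear; lia.
have [x [_ [xV _ _]]] := arr_edge arrV.
have t0 : 0 < t.+1 + 6 by [].
have := arr_min_degree hsym hirr alpha7 t0 arrV xV.
by have := alpha7 (tfV x xV); clear; lia.
Qed.

End LowerBound.

(** * From vertex colourings of the graph to [arr] *)

Lemma bigmax_mem (a : seq nat) : 0 < \max_(x <- a) x -> \max_(x <- a) x \in a.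
Proof.
elim: a => [|x a IHa]; first by rewrite big_nil.
rewrite big_cons; move: (\max_(x <- a) x) IHa => m IHm.
by rewrite inE /maxn; case: (x < m) => [/IHm->|]; rewrite ?orbT ?eqxx.
Qed.

(* The colour [i] is listed [a_i - 1] times: the union of that many independent
   colour classes contains no clique of size [a_i]. *)
Definition colour_groups (a : seq nat) : seq nat :=
  flatten [seq nseq (nth 0 a i).-1 i | i <- iota 0 (size a)].

Lemma size_colour_groups a : size (colour_groups a) = sumn [seq x.-1 | x <- a].
Proof.
rewrite size_flatten /shape -map_comp.
rewrite -[in RHS](mkseq_nth 0 a) /mkseq -map_comp; congr sumn.
by apply: eq_map => i /=; rewrite size_nseq.
Qed.

Lemma count_colour_groups a j : j < size a ->
  count_mem j (colour_groups a) = (nth 0 a j).-1.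
Proof.
move=> ja; rewrite count_flatten -map_comp sumnE big_map.
rewrite (bigD1_seq j) ?mem_iota ?iota_uniq //= count_nseq /= eqxx mul1n.
rewrite big1 ?addn0 // => i ij; by rewrite count_nseq /= (negbTE ij).
Qed.

Lemma colour_groups_lt a j : j \in colour_groups a -> j < size a.
Proof.
case/flattenP=> s /mapP[i]; rewrite mem_iota => /andP[_ ia] -> /nseqP[-> _].
exact: ia.
Qed.

(** Distribute the [t] classes among the colours other than [i0] according to [L] and give [i0] to
    the remaining vertices. A colour [i] other than [i0] cannot contain its clique, so [i0] contains
    a 7-clique. *)
Lemma arrows_arr (T : finType) (e : rel T) (a : seq nat) i0 : symmetric e ->
    all (fun x => 0 < x) a -> i0 < size a -> nth 0 a i0 = 7 -> vertex_arrows e a ->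
  arr (fun x y => (x != y) && ~~ e x y) [set: T] (mFolk a - 7).
Proof.
move=> esym apos i0a ai0 arrows f clf; set t := _ - 7 in clf *.
pose L := [seq i <- colour_groups a | i != i0].
have cntL i : i < size a -> i != i0 -> count_mem i L = (nth 0 a i).-1.
  move=> ia ii0; rewrite count_filter -(count_colour_groups ia).
  by apply: eq_count => j /=; case: eqVneq => //= ->.
have sL : size L = t.
  have := count_predC (pred1 i0) (colour_groups a).
  have -> : size L = count (predC (pred1 i0)) (colour_groups a) by rewrite size_filter.
  rewrite size_colour_groups count_colour_groups // ai0 /t /mFolk /=.
  by clear; lia.
pose o0 := Ordinal i0a.
(* The default of [insubd] is never reached, since all entries of [L] are below [size a]. *)
pose c x : 'I_(size a) := if f x < t then insubd o0 (nth i0 L (f x)) else o0.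
have cE x : f x < t -> nth i0 L (f x) = c x :> nat /\ nth i0 L (f x) != i0.
  move=> fx; have := mem_nth i0 (_ : f x < size L); rewrite sL => /(_ fx).
  rewrite mem_filter => /andP[ni0 /colour_groups_lt lt].
  by rewrite /c fx insubdK.
have [i [K [cK clK cKi]]] := arrows c.
have iK : indep (fun x y => (x != y) && ~~ e x y) K.
  apply/indepP=> x y xK yK; rewrite negb_and !negbK.
  by case: eqVneq => //= xy; apply: clK.
have [ii0|ii0] := eqVneq (i : nat) i0.
  exists K; split=> //; first by rewrite cK ii0.
  move=> x xK; rewrite leqNgt; apply/negP=> /cE[+ /eqP].
  by rewrite (cKi x xK) => ->.
have fK x : x \in K -> f x < t /\ nth i0 L (f x) = i.
  move=> xK; have [fx|fx] := ltnP (f x) t; first by have [-> _] := cE x fx; rewrite cKi.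
  by have := cKi x xK; rewrite /c ltnNge fx /= => E; rewrite -E eqxx in ii0.
have: #|K| <= count_mem (i : nat) L.
  have -> : count_mem (i : nat) L = size [seq j <- iota 0 t | nth i0 L j == i].
    by rewrite size_filter -sL -[in LHS](mkseq_nth i0 L) count_map.
  rewrite cardE -(size_map f); apply: uniq_leq_size.
    rewrite map_inj_in_uniq ?enum_uniq // => x y; rewrite !mem_enum => xK yK fxy.
    apply: contraTeq isT => xy; have [fx _] := fK x xK.
    have := clf x y (in_setT _) (in_setT _) fxy fx xy.
    by move/indepP: iK => /(_ x y xK yK)/negP.
  move=> j /mapP[x]; rewrite mem_enum => xK ->; have [fx nx] := fK x xK.
  by rewrite mem_filter nx eqxx mem_iota.
(* Positivity of [a_i] makes [a_i <= a_i - 1] absurd despite truncated subtraction. *)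
rewrite cntL // cK; have := allP apos (nth 0 a i); rewrite mem_nth // => /(_ isT).
by clear; lia.
Qed.

Theorem theorem6p4 :
  (forall a : seq nat,
     all (fun x => 0 < x) a ->
     \max_(x <- a) x = 7 ->
     13 <= mFolk a ->
     Fv_ge a 8 (3 * mFolk a - 10))
  /\ Fv_ge [:: 7; 7] 8 29.
Proof.
have main a : all (fun x => 0 < x) a -> \max_(x <- a) x = 7 -> 13 <= mFolk a ->
    Fv_ge a 8 (3 * mFolk a - 10).
  move=> apos amax am T e [esym eirr] arrows cl8.
  have a7 : 7 \in a by rewrite -amax bigmax_mem // amax.
  have := @arrows_arr T e a (index 7 a) esym apos; rewrite index_mem nth_index //.
  move/(_ a7 erefl arrows); set h := (fun x y : T => _) => arrV.
  have hsym : symmetric h by move=> x y; rewrite /h eq_sym esym.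
  have hirr : irreflexive h by move=> x; rewrite /h eqxx.
  have alpha7 I : indep h I -> #|I| <= 7.
    move=> /indepP iI; rewrite -ltnS; apply: cl8 => x y xI yI xy.
    by have := iI x y xI yI; rewrite /h xy negbK.
  (* With [m = mFolk a], [3 (m - 13) + 29 = 3 m - 10]. *)
  have := @arr_ge_from6 T h hsym hirr alpha7 (mFolk a - 13) [set: T].
  rewrite (_ : mFolk a - 13 + 6 = mFolk a - 7) => [/(_ arrV)|]; last first.
    by clear -am; lia.
  by rewrite cardsT; clear -am; lia.
(* Here [m = 13] and [3 * 13 - 10 = 29]. *)
split=> //; apply: (main [:: 7; 7]) => //.
by rewrite !big_cons big_nil.
Qed.
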